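(* Let $X=\{X(t)\}_{t\ge0}$ be a continuous-time Markov chain on a finite or countably infinite state space $I$ with infinitesimal generator $Q=\{q(i,j)\}_{i,j\in I}$ satisfying $\sup_{i\in I}|q(i,i)|<\infty$, and with initial distribution $\rho=\{\rho(i)\}_{i\in I}=\{\mathbb{P}(X(0)=i)\}_{i\in I}$. Let $X_1,\dots,X_N$ be $N\ge1$ independent and identically distributed realizations of $X$. Let $U_{\mathrm{T}}\subseteq I$ be a finite target set, and let $$S_N(t):=\bigcup_{n=1}^N\bigcup_{s\in[0,t]}\{X_n(s)\},\qquad \sigma_N:=\inf\{t>0:U_{\mathrm{T}}\subseteq S_N(t)\}$$ be, respectively, the set of states visited by at least one searcher by time $t$ and the cover time of $U_{\mathrm{T}}$. For $j\in I$ let $\tau_n(j):=\inf\{t>0:X_n(t)=j\}$ and $T_N(j):=\min\{\tau_1(j),\dots,\tau_N(j)\}$. Assume (i) $U_{\mathrm{T}}\not\subseteq\mathrm{supp}(\rho)$, where $\mathrm{supp}(\rho):=\{i\in I:\rho(i)>0\}$; and (ii) for each $j\in U_{\mathrm{T}}$, $\mathbb{E}[T_N(j)]<\infty$ for some $N\ge1$. Then for every $m\in(0,\infty)$, $$\mathbb{E}[\sigma_N^m]\sim\frac{K_m}{N^{m/d}}\quad\text{as }N\to\infty,$$ i.e. $N^{m/d}\mathbb{E}[\sigma_N^m]\to K_m$, where $d$ and $K_m$ are defined in the context below.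
   Context: The generator $Q$ has nonnegative off-diagonal entries $q(i,j)$ (the jump rate from $i$ to $j\neq i$) and nonpositive diagonal entries chosen so that each row sums to zero. A path of length $k\in\mathbb{Z}_{\ge0}$ is a sequence $\mathcal{P}=(\mathcal{P}(0),\dots,\mathcal{P}(k))\in I^{k+1}$ with $q(\mathcal{P}(j),\mathcal{P}(j+1))>0$ for all $j\in\{0,\dots,k-1\}$; its weight is $\lambda(\mathcal{P}):=\prod_{j=0}^{k-1}q(\mathcal{P}(j),\mathcal{P}(j+1))$. For $I_0,I_1\subseteq I$, let $d_{\min}(I_0,I_1):=\inf\{k:\ \text{there is a path }\mathcal{P}\in I^{k+1}\text{ with }\mathcal{P}(0)\in I_0,\ \mathcal{P}(k)\in I_1\}$ (the smallest number of jumps needed to go from $I_0$ to $I_1$), and let $\mathcal{S}(I_0,I_1)$ be the set of all paths $\mathcal{P}$ of length $k=d_{\min}(I_0,I_1)$ with $\mathcal{P}(0)\in I_0$ and $\mathcal{P}(k)\in I_1$. For $J\subseteq I$ define $$\Lambda(\rho,J):=\sum_{\mathcal{P}\in\mathcal{S}(\mathrm{supp}(\rho),J)}\rho(\mathcal{P}(0))\,\lambda(\mathcal{P}).$$ Define $d:=\sup_{j\in U_{\mathrm{T}}}d_{\min}(\mathrm{supp}(\rho),\{j\})\ge1$, the set $U_{\mathrm{T}}^{\mathrm{far}}:=\{j\in U_{\mathrm{T}}:d_{\min}(\mathrm{supp}(\rho),\{j\})=d\}$, and $$K_m:=\Gamma\Big(1+\frac{m}{d}\Big)\sum_{i=1}^{|U_{\mathrm{T}}^{\mathrm{far}}|}\bigg[(-1)^{i-1}\sum_{J\subseteq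 U_{\mathrm{T}}^{\mathrm{far}},\ |J|=i}\Big(\frac{d!}{\Lambda(\rho,J)}\Big)^{m/d}\bigg],$$ where the inner sum is over all subsets $J$ of $U_{\mathrm{T}}^{\mathrm{far}}$ of size $i$. Here $f\sim g$ means $f/g\to1$. *)

(* Defs.v *)
From HB Require Import structures.
From mathcomp Require Import all_boot all_order all_algebra finmap.
From mathcomp Require Import all_classical all_reals all_analysis.

Set Implicit Arguments.
Unset Strict Implicit.
Unset Printing Implicit Defensive.

Import Order.TTheory GRing.Theory Num.Theory.
Local Open Scope classical_set_scope.

Local Open Scope ring_scope.

Section CTMC.
Variables (R : realType) (I : countType) (q : I -> I -> R) (rho : I -> R).

Definition is_generator : Prop :=
  (forall i j, i != j -> 0 <= q i j) /\
  (forall i, q i i <= 0) /\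
  (forall i, (\esum_(j in [set j | j != i]) (q i j)%:E = (- q i i)%:E)%E).

Definition bounded_rates : Prop := exists M : R, forall i, `|q i i| <= M.

Definition is_distribution : Prop :=
  (forall i, 0 <= rho i) /\ (\esum_(i in [set: I]) (rho i)%:E = 1)%E.

Definition supp : set I := [set i | 0 < rho i].

(** ----- Transition function P(t) = exp(tQ), via uniformization ----- *)

Definition unif_rate : R := sup [set `|q i i| | i in [set: I]] + 1.

Definition Pi (i j : I) : R := (i == j)%:R + q i j / unif_rate.

Fixpoint Pi_pow (k : nat) (i j : I) : R :=
  match k with
  | 0 => (i == j)%:R
  | k'.+1 => fine (\esum_(l in [set: I]) (Pi_pow k' i l * Pi l j)%:E)
  end.

(* P_t(i,j) = sum_k e^{-lam t} (lam t)^k / k! * Pi^k(i,j)  ( = exp(tQ)(i,j) ) *)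
Definition Ptrans (t : R) (i j : I) : R :=
  fine (\esum_(k in [set: nat])
          (expR (- (unif_rate * t)) * (unif_rate * t) ^+ k / (k`!)%:R
             * Pi_pow k i j)%:E).

(* finite-dimensional distributions of the chain started from rho:
   for s = [:: (t0,i0); ...; (tk,ik)] with 0 <= t0 <= ... <= tk,
   P(X(t0)=i0, ..., X(tk)=ik). *)
Fixpoint chain_prob (t : R) (i : I) (s : seq (R * I)) : R :=
  match s with
  | [::] => 1
  | (t', j) :: s' => Ptrans (t' - t) i j * chain_prob t' j s'
  end.

Definition fdd (s : seq (R * I)) : R :=
  match s with
  | [::] => 1
  | (t0, i0) :: s' =>
      fine (\esum_(x in [set: I]) (rho x * Ptrans t0 x i0)%:E) * chain_prob t0 i0 s'
  end.

Definition admissible_times (s : seq (R * I)) : bool :=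
  all (fun p => 0 <= p.1) s && sorted (fun a b => a.1 <= b.1) s.

(* X : nat -> Omega -> R -> I is a sequence of i.i.d. continuous-time Markov
   chains with generator q and initial law rho, with right-constant
   (right-continuous for the discrete topology) sample paths on [0,oo). *)
Definition iid_CTMC {d : measure_display} {Omega : measurableType d}
  (P : probability Omega R) (X : nat -> Omega -> R -> I) : Prop :=
  (forall n t i, measurable [set w | X n w t = i]) /\
  (forall n w t, 0 <= t ->
     exists2 e : R, 0 < e & forall s, t <= s < t + e -> X n w s = X n w t) /\
  (* joint law of the first (size ss) copies: product of the chain f.d.d.'s,
     i.e. each copy is a CTMC(q, rho) and the copies are independent *)
  (forall ss : seq (seq (R * I)), all admissible_times ss ->
     P [set w | forall n, (n < size ss)%N ->
                  all (fun p => X n w p.1 == p.2) (nth [::] ss n)]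
     = (\prod_(s <- ss) fdd s)%:E).

Section Search.
Variables (Omega : Type) (X : nat -> Omega -> R -> I).

Definition visited (N : nat) (w : Omega) (t : R) : set I :=
  [set j | exists n s, (n < N)%N /\ 0 <= s <= t /\ X n w s = j].

Definition cover_time (UT : {fset I}) (N : nat) (w : Omega) : \bar R :=
  ereal_inf [set t%:E | t in [set t : R | 0 < t /\ [set j | j \in UT] `<=` visited N w t]].

Definition hit_time (n : nat) (j : I) (w : Omega) : \bar R :=
  ereal_inf [set t%:E | t in [set t : R | 0 < t /\ X n w t = j]].

Definition first_hit (N : nat) (j : I) (w : Omega) : \bar R :=
  \big[Order.min/+oo%E]_(n < N) hit_time n j w.
End Search.

(* a path (P(0), ..., P(k)) is encoded as (x0, s) with x0 = P(0),
   s = [:: P(1); ...; P(k)], k = size s *)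
Definition is_path (x0 : I) (s : seq I) : bool := path (fun a b => 0 < q a b) x0 s.

Definition path_weight (x0 : I) (s : seq I) : R :=
  \prod_(i < size s) q (nth x0 (x0 :: s) i) (nth x0 s i).

Definition path_between (k : nat) (I0 I1 : set I) (x0 : I) (s : seq I) : Prop :=
  size s = k /\ is_path x0 s /\ I0 x0 /\ I1 (last x0 s).

Definition reachable_in (k : nat) (I0 I1 : set I) : Prop :=
  exists x0 s, path_between k I0 I1 x0 s.

(* d_min(I0, I1) : least number of jumps from I0 to I1
   (convention: 0 if I1 is unreachable from I0; this never matters below,
   since hypothesis (ii) of the theorem forces reachability) *)
Definition dmin (I0 I1 : set I) : nat :=
  match pselect (exists k, reachable_in k I0 I1) with
  | left h =>
      @ex_minn (fun k => `[< reachable_in k I0 I1 >])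
        (let: ex_intro k hk := h in ex_intro _ k (asboolT hk))
  | right _ => 0%N
  end.

Definition Lambda (J : set I) : R :=
  fine (\esum_(p in [set p : I * seq I | path_between (dmin supp J) supp J p.1 p.2])
          (rho p.1 * path_weight p.1 p.2)%:E).

Definition dfar (UT : {fset I}) : nat := (\max_(j <- UT) dmin supp [set j])%N.

Definition UTfar (UT : {fset I}) : {fset I} :=
  [fset j in UT | dmin supp [set j] == dfar UT]%fset.

End CTMC.

Definition Gamma {R : realType} (x : R) : R :=
  fine (integral (@lebesgue_measure R) `]0%R, +oo[
          (fun t : R => ((t `^ (x - 1)) * expR (- t))%:E)).

Definition Kconst {R : realType} {I : countType} (q : I -> I -> R) (rho : I -> R)
  (UT : {fset I}) (m : R) : R :=
  let d := dfar q rho UT in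
  let F := UTfar q rho UT in
  Gamma (1 + m / d%:R) *
  \sum_(1 <= i < #|{: F}|.+1)
     ((-1) ^+ i.-1 *
      \sum_(J : {set F} | #|J| == i)
         ((d`!)%:R / Lambda q rho [set val x | x in [set x | x \in J]]) `^ (m / d%:R)).

(* Main.v *)
Require Import Defs.
From HB Require Import structures.
From mathcomp Require Import all_boot all_order all_algebra finmap.
From mathcomp Require Import all_classical all_reals all_analysis.
From mathcomp Require Import measurable_realfun.
From mathcomp Require Import ring lra.
Import Order.TTheory GRing.Theory Num.Theory.
Import numFieldNormedType.Exports.
Local Open Scope classical_set_scope.
Local Open Scope ring_scope.

(** Uniformization writes the transition function as a Poisson mixture of powers
    of a stochastic matrix; only minimal paths contribute to the leading term, so
    the occupation probability of J at time t is Lambda(J) t^k / k! (1 + o(1)) with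
    k the distance of J from supp(rho).  By the Markov property at the entrance time,
    the probability of having hit J before t lies between the occupation probability
    and exp(lam t) times it, which gives 1 - S_J(t) ~ Lambda(J) t^k / k! for the
    survival function S_J.  By independence N searchers all avoid J up to t with
    probability S_J(t)^N, and at the time scale t = y^(1/m) N^(-1/d) this tends to
    exp(- Lambda(J) y^(d/m) / d!) if k = d and to 0 if k < d.  The event
    [sigma_N >= t] is the union over the targets j of the events that j is avoided;
    the near targets are negligible, and inclusion-exclusion over the far ones together
    with the layer cake formula reduces the moment to integrals of S_J(t)^N.
    Dominated convergence applies because for t <= 1 the bound is a stretched
    exponential in y, while hypothesis (ii) gives the tail S_j(t)^M <= C / t, which
    becomes as thin as needed once N is a large multiple of M.  Each limit integral is again a layer
    cake, of u^(m/d) against exp(-u), whence the Gamma factor. *)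

(** * Uniformization *)

Section esum_extra.
Context {R : realType}.
Local Open Scope ereal_scope.

Lemma esum_swap (S T : choiceType) (A : set S) (B : set T) (a : S -> T -> \bar R) :
  (forall i j, A i -> B j -> 0 <= a i j) ->
  \esum_(i in A) \esum_(j in B) a i j = \esum_(j in B) \esum_(i in A) a i j.
Proof.
move=> a0.
rewrite (esum_esum (J := fun=> B))// (esum_esum (J := fun=> A)) => [|? ? ? ?]; last exact: a0.
rewrite (reindex_esum (B `*`` (fun=> A)) _ (fun x => (x.2, x.1)))//; split=> //=.
- by move=> [i j] [].
- by move=> [i1 i2] [j1 j2] /= _ _ [] -> ->.
- by move=> [i1 i2] [Pi1 Qi2] /=; exists (i2, i1).
Qed.

Lemma esumZl (T : choiceType) (A : set T) (c : R) (a : T -> \bar R) :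
  (0 <= c)%R -> (forall i, A i -> 0 <= a i) ->
  \esum_(i in A) (c%:E * a i) = c%:E * \esum_(i in A) a i.
Proof.
move=> c0 a0.
have le (c' : R) (b : T -> \bar R) : (0 <= c')%R -> (forall i, A i -> 0 <= b i) ->
    \esum_(i in A) (c'%:E * b i) <= c'%:E * \esum_(i in A) b i.
  move=> c'0 b0; apply: ge_ereal_sup => _ [X [finX XA] <-].
  rewrite fsbig_finite//= big_seq -ge0_sume_distrr; last first.
    by move=> i; rewrite in_fset_set// inE => /XA/b0.
  rewrite -big_seq -fsbig_finite//; apply: lee_wpmul2l => //.
  by apply: ereal_sup_ubound; exists X.
move: c0; rewrite le_eqVlt => /predU1P[<-|c0].
  by rewrite mul0e esum1// => i _; rewrite mul0e.
apply/eqP; rewrite eq_le le ?(ltW c0)//=.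
(* The reverse inequality is the bound [le] for the factor [c^-1], applied to the family already
   multiplied by [c]. *)
rewrite -[leRHS]mul1e -[1](_ : c%:E * (c^-1)%:E = _); last by rewrite -EFinM divff ?gt_eqF.
rewrite -muleA; apply: lee_wpmul2l; first by rewrite lee_fin ltW.
apply: le_trans (le _ _ _ _); last 2 first.
- by rewrite invr_ge0 ltW.
- by move=> i Ai; rewrite mule_ge0 ?a0// lee_fin ltW.
apply: le_esum => i Ai; rewrite muleA -EFinM mulVf ?gt_eqF// mul1e//.
Qed.

Lemma esum_ge_term (T : choiceType) (A : set T) (a : T -> \bar R) x :
  A x -> (forall i, A i -> 0 <= a i) -> a x <= \esum_(i in A) a i.
Proof.
move=> Ax a0; rewrite (esumID [set x])//.
rewrite (_ : A `&` [set x] = [set x]); last by apply/seteqP; split=> y /= => [[]|->].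
by rewrite esum_set1 ?a0// leeDl// esum_ge0// => i [/a0].
Qed.

Lemma esum_single (T : choiceType) (A : set T) (a : T -> \bar R) x :
  A x -> 0 <= a x -> (forall i, A i -> i != x -> a i = 0) ->
  \esum_(i in A) a i = a x.
Proof.
move=> Ax ax a0; rewrite (esumID [set x]); last first.
  by move=> i Ai; have [->//|/a0->] := eqVneq i x.
rewrite (_ : A `&` [set x] = [set x]); last by apply/seteqP; split=> y /= => [[]|->].
by rewrite esum_set1// [X in _ + X]esum1 ?adde0// => i [Ai /eqP]; exact: a0.
Qed.

Lemma subset_esum (T : choiceType) (A B : set T) (a : T -> \bar R) :
  A `<=` B -> (forall i, B i -> 0 <= a i) ->
  \esum_(i in A) a i <= \esum_(i in B) a i.
Proof.
move=> AB a0; rewrite [leRHS](esumID A)//.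
by rewrite (setIidr AB) leeDl// esum_ge0// => i [/a0].
Qed.

End esum_extra.

(** * Poisson weights and their tails *)

Section poisson.
Context {R : realType}.

Definition pois (x : R) (k : nat) : R := expR (- x) * x ^+ k / (k`!)%:R.

Lemma pois_ge0 x k : 0 <= x -> 0 <= pois x k.
Proof. by move=> x0; rewrite /pois divr_ge0// mulr_ge0 ?expR_ge0// exprn_ge0. Qed.

Lemma esum_exp_coeff (x : R) : 0 <= x ->
  (\esum_(k in [set: nat]) (x ^+ k / (k`!)%:R)%:E = (expR x)%:E)%E.
Proof.
move=> x0.
have c0 k : (0 <= (x ^+ k / (k`!)%:R)%:E)%E by rewrite lee_fin divr_ge0// exprn_ge0.
rewrite -nneseries_esumT//; apply/cvg_lim => //.
rewrite (_ : (fun n => _) = EFin \o series (exp_coeff x)).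
  by apply: cvg_EFin; [exact: nearW|exact: is_cvg_series_exp_coeff].
by apply/funext => n /=; rewrite sumEFin.
Qed.

Lemma esum_pois (x : R) : 0 <= x -> (\esum_(k in [set: nat]) (pois x k)%:E = 1)%E.
Proof.
move=> x0.
transitivity (\esum_(k in [set: nat]) ((expR (- x))%:E * (x ^+ k / (k`!)%:R)%:E))%E.
  by apply: eq_esum => k _; rewrite -EFinM /pois mulrA.
rewrite esumZl ?expR_ge0//; last by move=> k _; rewrite lee_fin divr_ge0// exprn_ge0.
by rewrite esum_exp_coeff// -EFinM -expRD addNr expR0.
Qed.

(* x^(n+s)/(n+s)! <= x^n * x^s/s! *)
Lemma esum_pois_tail (x : R) n : 0 <= x ->
  (\esum_(k in [set k | (n <= k)%N]) (pois x k)%:E <= (x ^+ n)%:E)%E.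
Proof.
move=> x0.
rewrite (reindex_esum [set: nat] _ (addn n)); last first.
  split=> [k _ /=|k l _ _ /addnI//|k /= nk]; first exact: leq_addr.
  by exists (k - n)%N => //; rewrite subnKC.
rewrite -[leRHS]mule1 -(esum_pois x x0) -esumZl ?exprn_ge0//; last first.
  by move=> k _; rewrite lee_fin pois_ge0.
apply: le_esum => k _; rewrite -EFinM lee_fin /pois exprD.
rewrite !mulrA [expR _ * _]mulrC -!mulrA.
do 3 (apply: ler_wpM2l; first by rewrite ?exprn_ge0 ?expR_ge0).
rewrite lef_pV2 ?posrE ?ltr0n ?fact_gt0// ler_nat.
by rewrite leq_fact// leq_addl.
Qed.

End poisson.

(** * Powers of the uniformized kernel and the transition function *)

Section uniformization.
Context {R : realType} {I : countType}.
Variables (q : I -> I -> R) (rho : I -> R).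
Hypothesis qgen : is_generator q.
Hypothesis qbnd : bounded_rates q.
Hypothesis rhoP : is_distribution rho.
Local Notation lam := (unif_rate q).

(** Bounded rates make the supremum inside [unif_rate] a genuine upper bound; the added 1 leaves a
    margin that keeps [unif_rate] positive and the holding probabilities [Pi i i] nonnegative. *)
Lemma q_diag_le i : `|q i i| <= lam - 1.
Proof.
case: qbnd => M qM; rewrite /unif_rate addrK; apply: ub_le_sup; last by exists i.
by exists M => _ [j _ <-].
Qed.

Lemma state_inhabited : exists i : I, True.
Proof.
case: rhoP => _; case: (pselect (exists i : I, True)) => // nI.
rewrite esum1 => [/eqP|i]; first by rewrite eq_sym onee_eq0.
by case: nI; exists i.
Qed.

Lemma unif_rate_gt0 : 0 < lam.
Proof.
have [i _] := state_inhabited.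
by have := le_trans (normr_ge0 _) (q_diag_le i); rewrite subr_ge0; apply: lt_le_trans.
Qed.

Lemma Pi_ge0 i j : 0 <= Pi q i j.
Proof.
case: qgen => q0 _; rewrite /Pi; have [<-|ij] := eqVneq i j; last first.
  by rewrite add0r divr_ge0 ?q0// ltW// unif_rate_gt0.
have := q_diag_le i; rewrite ler_norml => /andP[+ _].
move=> h.
rewrite -(ler_pM2r unif_rate_gt0) mul0r mulrDl mul1r divfK ?gt_eqF ?unif_rate_gt0//.
by lra.
Qed.

Lemma esum_Pi i : (\esum_(j in [set: I]) (Pi q i j)%:E = 1)%E.
Proof.
case: qgen => q0 [_ qs].
rewrite (esumID [set i]); last by move=> j _; rewrite lee_fin Pi_ge0.
rewrite !setTI esum_set1 ?lee_fin ?Pi_ge0//.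
have -> : (\esum_(j in ~` [set i]) (Pi q i j)%:E
    = \esum_(j in [set j | j != i]) ((lam^-1)%:E * (q i j)%:E))%E.
  rewrite (_ : ~` [set i] = [set j | j != i]); last first.
    by apply/seteqP; split=> j /= /eqP.
  by apply: eq_esum => j /= ji; rewrite /Pi eq_sym (negbTE ji) add0r mulrC EFinM.
rewrite esumZl ?invr_ge0 ?(ltW unif_rate_gt0)//; last first.
  by move=> j /= ji; rewrite lee_fin q0// eq_sym.
by rewrite qs -EFinM /Pi eqxx -EFinD mulrN [q i i / _]mulrC addrK.
Qed.

(** The three facts are proved together: [Pi_pow] is defined through [fine], so the recursion holds
    in the extended reals only once its sum is known to be finite, and this comes from the row sums
    of the previous power. *)
Lemma Pi_pow_spec k i : (forall j, 0 <= Pi_pow q k i j) /\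
  (\esum_(j in [set: I]) (Pi_pow q k i j)%:E = 1)%E /\
  (forall j, (Pi_pow q k.+1 i j)%:E =
     \esum_(l in [set: I]) (Pi_pow q k i l * Pi q l j)%:E)%E.
Proof.
have fin_step k' : (forall j, 0 <= Pi_pow q k' i j) ->
   (\esum_(j in [set: I]) (Pi_pow q k' i j)%:E = 1)%E ->
   \esum_(j in [set: I]) \esum_(l in [set: I]) (Pi_pow q k' i l * Pi q l j)%:E = 1%E.
  move=> p0 p1; rewrite esum_swap => [|? ? _ _]; last by rewrite lee_fin mulr_ge0 ?Pi_ge0.
  rewrite -[RHS]p1; apply: eq_esum => l _.
  under eq_esum do rewrite EFinM.
  by rewrite esumZl ?esum_Pi ?mule1// => j _; rewrite lee_fin Pi_ge0.
have E k' : (forall j, 0 <= Pi_pow q k' i j) ->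
   (\esum_(j in [set: I]) (Pi_pow q k' i j)%:E = 1)%E -> forall j,
   ((Pi_pow q k'.+1 i j)%:E = \esum_(l in [set: I]) (Pi_pow q k' i l * Pi q l j)%:E)%E.
  move=> p0 p1 j; rewrite /= fineK// ge0_fin_numE; last first.
    by apply: esum_ge0 => l _; rewrite lee_fin mulr_ge0 ?Pi_ge0.
  apply: le_lt_trans (ltry 1); rewrite -(fin_step k')//.
  apply: (@esum_ge_term _ _ _ (fun j => \esum_(l in [set: I]) (Pi_pow q k' i l * Pi q l j)%:E)) => //.
  by move=> x _; apply: esum_ge0 => l _; rewrite lee_fin mulr_ge0 ?Pi_ge0.
elim: k => [|k [p0 [p1 pS]]]; last first.
  have p0' j : 0 <= Pi_pow q k.+1 i j.
    by rewrite -lee_fin pS; apply: esum_ge0 => l _; rewrite lee_fin mulr_ge0 ?Pi_ge0.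
  have p1' : (\esum_(j in [set: I]) (Pi_pow q k.+1 i j)%:E = 1)%E.
    by rewrite -(fin_step k p0 p1); apply: eq_esum => j _; rewrite pS.
  by split=> //; split=> // j; rewrite E.
have p0 j : 0 <= Pi_pow q 0 i j by [].
have p1 : (\esum_(j in [set: I]) (Pi_pow q 0 i j)%:E = 1)%E.
  rewrite (@esum_single _ _ _ _ i)//= ?eqxx//.
  by move=> j _ ji; rewrite eq_sym (negbTE ji).
by split=> //; split=> // j; rewrite E.
Qed.

Lemma Pi_pow_ge0 k i j : 0 <= Pi_pow q k i j.
Proof. by have [] := Pi_pow_spec k i. Qed.

Lemma esum_Pi_pow k i : (\esum_(j in [set: I]) (Pi_pow q k i j)%:E = 1)%E.
Proof. by have [_ []] := Pi_pow_spec k i. Qed.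

Lemma Pi_powS k i j :
  ((Pi_pow q k.+1 i j)%:E = \esum_(l in [set: I]) (Pi_pow q k i l * Pi q l j)%:E)%E.
Proof. by have [_ []] := Pi_pow_spec k i. Qed.

Lemma Pi_pow_le1 k i j : Pi_pow q k i j <= 1.
Proof.
rewrite -lee_fin -(esum_Pi_pow k i).
by apply: (@esum_ge_term _ _ _ (fun j => (Pi_pow q k i j)%:E)) => // x _; rewrite lee_fin Pi_pow_ge0.
Qed.

Lemma lamt_ge0 t : 0 <= t -> 0 <= lam * t.
Proof. by move=> t0; rewrite mulr_ge0// ltW// unif_rate_gt0. Qed.

Lemma PtransE t i j : 0 <= t -> ((Ptrans q t i j)%:E =
  \esum_(k in [set: nat]) (pois (lam * t) k * Pi_pow q k i j)%:E)%E.
Proof.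
move=> t0; rewrite /Ptrans fineK// ge0_fin_numE; last first.
  by apply: esum_ge0 => k _; rewrite lee_fin mulr_ge0 ?Pi_pow_ge0 ?pois_ge0 ?lamt_ge0.
apply: le_lt_trans (ltry 1); rewrite -(esum_pois (lam * t)) ?lamt_ge0//.
apply: le_esum => k _; rewrite lee_fin -[leRHS]mulr1 ler_wpM2l ?Pi_pow_le1//.
by rewrite pois_ge0 ?lamt_ge0.
Qed.

Lemma Ptrans_ge0 t i j : 0 <= t -> 0 <= Ptrans q t i j.
Proof.
move=> t0; rewrite -lee_fin PtransE//; apply: esum_ge0 => k _.
by rewrite lee_fin mulr_ge0 ?Pi_pow_ge0 ?pois_ge0 ?lamt_ge0.
Qed.

(** Only the term [k = 0] is kept, where the Poisson clock has not rung before [t]. This bound is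
    the source of the factor exp(lam t) between hitting and occupation probabilities. *)
Lemma Ptrans_diag_ge t j : 0 <= t -> expR (- (lam * t)) <= Ptrans q t j j.
Proof.
move=> t0; rewrite -lee_fin PtransE//.
apply: le_trans (@esum_ge_term _ _ _ _ 0%N _ _) => //=.
  by rewrite eqxx /pois expr0 fact0 divr1 !mulr1.
by move=> k _; rewrite lee_fin mulr_ge0 ?Pi_pow_ge0 ?pois_ge0 ?lamt_ge0.
Qed.

End uniformization.

(** * Paths and short-time occupation probabilities *)

Section walks.
Context {R : realType} {I : countType}.
Variables (q : I -> I -> R) (rho : I -> R).
Hypothesis qgen : is_generator q.
Hypothesis qbnd : bounded_rates q.
Hypothesis rhoP : is_distribution rho.
Local Notation lam := (unif_rate q).
Let lam_gt0 : 0 < lam := unif_rate_gt0 q rho qbnd rhoP.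
Let PiG0 := Pi_ge0 q rho qgen qbnd rhoP.
Let PpG0 := Pi_pow_ge0 q rho qgen qbnd rhoP.

Let rho_ge0 x : 0 <= rho x. Proof. by case: rhoP. Qed.
Let esum_rho : (\esum_(i in [set: I]) (rho i)%:E = 1)%E. Proof. by case: rhoP. Qed.

Lemma path_weight_rcons x s y :
  path_weight q x (rcons s y) = path_weight q x s * q (last x s) y.
Proof.
rewrite /path_weight size_rcons big_ord_recr /=; congr (_ * _); last first.
  by rewrite nth_rcons ltnn eqxx -rcons_cons nth_rcons /= ltnSn (last_nth x).
apply: eq_bigr => i _.
by rewrite -rcons_cons !nth_rcons /= ltn_ord ltnS (ltnW (ltn_ord i)).
Qed.

Lemma path_weight_gt0 x s : is_path q x s -> 0 < path_weight q x s.
Proof.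
elim/last_ind: s => [_|s y IH]; first by rewrite /path_weight big_ord0.
by rewrite /is_path rcons_path => /andP[/IH ? ?]; rewrite path_weight_rcons mulr_gt0.
Qed.

(* Weight of a walk of the uniformized chain, in which steps may be holding steps. *)
Definition walk_weight (x : I) (s : seq I) : R :=
  \prod_(i < size s) (lam * Pi q (nth x (x :: s) i) (nth x s i)).

Lemma walk_weight_rcons x s y :
  walk_weight x (rcons s y) = walk_weight x s * (lam * Pi q (last x s) y).
Proof.
rewrite /walk_weight size_rcons big_ord_recr /=; congr (_ * _); last first.
  by rewrite nth_rcons ltnn eqxx -rcons_cons nth_rcons /= ltnSn (last_nth x).
apply: eq_bigr => i _.
by rewrite -rcons_cons !nth_rcons /= ltn_ord ltnS (ltnW (ltn_ord i)).
Qed.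

Lemma walk_weight_ge0 x s : 0 <= walk_weight x s.
Proof. by apply: prodr_ge0 => i _; rewrite mulr_ge0 ?PiG0// ltW. Qed.

(** Consecutive states of a path differ because diagonal rates are nonpositive, and off the diagonal
    [lam * Pi] is just [q]. *)
Lemma walk_weight_path x s : is_path q x s -> walk_weight x s = path_weight q x s.
Proof.
elim/last_ind: s => [_|s y IH]; first by rewrite /path_weight /walk_weight !big_ord0.
rewrite /is_path rcons_path => /andP[/IH e qy]; rewrite path_weight_rcons walk_weight_rcons e.
congr (_ * _); rewrite /Pi; have [ly|_] := eqVneq (last x s) y.
  by move: qy; case: qgen => _ [/(_ y) + _]; rewrite ly ltNge => ->.
by rewrite add0r mulrC divfK// gt_eqF.
Qed.

(* Deleting the holding steps of a walk leaves a path. *)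
Lemma walk_path x s : walk_weight x s != 0 ->
  exists s', [/\ is_path q x s', last x s' = last x s, (size s' <= size s)%N
    & size s' = size s -> is_path q x s].
Proof.
elim/last_ind: s => [_|s y IH]; first by exists [::].
rewrite walk_weight_rcons mulf_eq0 negb_or => /andP[/IH[s' [ps' ls' ss' es']]].
rewrite mulf_eq0 negb_or => /andP[_]; rewrite /Pi.
have [ly _|ly] := eqVneq (last x s) y.
  exists s'; split=> //; rewrite ?last_rcons ?size_rcons ?ls'//.
    exact: leq_trans ss' _.
  by move=> e; move: ss'; rewrite e ltnn.
rewrite add0r mulf_eq0 negb_or => /andP[q0 _].
have qy : 0 < q (last x s) y by rewrite lt_neqAle eq_sym q0; case: qgen => /(_ _ _ ly).
exists (rcons s' y); split.
- by rewrite /is_path rcons_path ls' qy andbT.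
- by rewrite !last_rcons.
- by rewrite !size_rcons ltnS.
- by rewrite !size_rcons => -[/es']; rewrite /is_path rcons_path qy andbT.
Qed.

Lemma dmin_min (A B : set I) k : reachable_in q k A B -> (dmin q A B <= k)%N.
Proof.
move=> h; rewrite /dmin; case: pselect => [e|[]]; last by exists k.
by case: ex_minnP => m _; apply; apply/asboolP.
Qed.

Lemma dmin_reachable (A B : set I) : (exists k, reachable_in q k A B) ->
  reachable_in q (dmin q A B) A B.
Proof.
move=> h; rewrite /dmin; case: pselect => [e|[]]//.
by case: ex_minnP => m /asboolP.
Qed.

Definition walks_to (k : nat) (J : set I) : set (I * seq I) :=
  [set p | size p.2 = k /\ J (last p.1 p.2)].

(** The probability that the uniformized discrete chain started from [rho] is in [J] after [k]
    steps. *)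
Definition occ (k : nat) (J : set I) : \bar R :=
  (\esum_(y in J) \esum_(x in [set: I]) (rho x * Pi_pow q k x y)%:E)%E.

(** Induction on [k], splitting a walk at its last step. The factor [lam ^+ k] turns the
    probabilities [Pi] into rates, so that walks can be compared with products of [q]. *)
Lemma occ1_walks k y : ((lam ^+ k)%:E * (\esum_(x in [set: I]) (rho x * Pi_pow q k x y)%:E)
  = \esum_(p in walks_to k [set y]) (rho p.1 * walk_weight p.1 p.2)%:E)%E.
Proof.
elim: k y => [|k IH] y.
  rewrite expr0 mul1e (@esum_single _ _ _ _ y)//=; last 2 first.
  - by rewrite eqxx mulr1 lee_fin.
  - by move=> i _ /negbTE->; rewrite mulr0.
  rewrite (_ : walks_to 0 _ = [set (y, [::])]); last first.
    by apply/seteqP; split=> [[x s] [/= /size0nil -> /= ->]|_ ->].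
  by rewrite esum_set1 /= ?lee_fin /walk_weight ?big_ord0 ?eqxx ?mulr1.
transitivity (\esum_(l in [set: I]) ((lam * Pi q l y)%:E *
    (\esum_(p in walks_to k [set l]) (rho p.1 * walk_weight p.1 p.2)%:E)))%E; last first.
  transitivity (\esum_(l in [set: I]) \esum_(p in walks_to k [set l])
      (rho p.1 * walk_weight p.1 p.2 * (lam * Pi q l y))%:E)%E.
    apply: eq_esum => l _; rewrite -esumZl ?mulr_ge0 ?PiG0 ?ltW//; last first.
      by move=> p _; rewrite lee_fin mulr_ge0 ?walk_weight_ge0.
    by apply: eq_esum => p _; rewrite -EFinM mulrC.
  rewrite esum_esum; last first.
    by move=> l p _ _; rewrite lee_fin !mulr_ge0 ?walk_weight_ge0 ?PiG0// ltW.
  rewrite [RHS](reindex_esum ([set: I] `*`` (fun l => walks_to k [set l])) _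
    (fun lp => (lp.2.1, rcons lp.2.2 y))).
    apply: eq_esum => -[l [x s]] /= [_ [_ /= <-]].
    by rewrite walk_weight_rcons; congr (_%:E); ring.
  split=> [[l [x s]] /= [_ [/= <- _]]|[l1 [x1 s1]] [l2 [x2 s2]]|[x s] [/= ss ls]].
  - by split=> /=; rewrite ?size_rcons ?last_rcons.
  - rewrite !inE /= => -[_ [_ /= <-]] [_ [_ /= <-]] [-> /rcons_inj[->]]//.
  - move: ss ls; case/lastP: s => // s z; rewrite size_rcons last_rcons => -[ss] zy.
    by exists (last x s, (x, s)); rewrite /= ?zy.
under [RHS]eq_esum do rewrite -IH.
transitivity ((lam ^+ k.+1)%:E * (\esum_(x in [set: I]) \esum_(l in [set: I])
   (rho x * (Pi_pow q k x l * Pi q l y))%:E))%E.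
  congr (_ * _)%E; apply: eq_esum => x _.
  rewrite EFinM (Pi_powS q rho)// -esumZl//.
  by move=> l _; rewrite lee_fin mulr_ge0 ?PiG0 ?PpG0.
rewrite esum_swap => [|? ? _ _]; last by rewrite lee_fin !mulr_ge0 ?PiG0 ?PpG0.
rewrite -esumZl ?exprn_ge0 ?(ltW lam_gt0)//; last first.
  by move=> l _; apply: esum_ge0 => x _; rewrite lee_fin !mulr_ge0 ?PiG0 ?PpG0.
apply: eq_esum => l _; rewrite muleA -EFinM -!esumZl; last first.
- by move=> x _; rewrite lee_fin !mulr_ge0 ?PiG0 ?PpG0.
- by rewrite exprn_ge0 ?(ltW lam_gt0).
- by move=> x _; rewrite lee_fin !mulr_ge0 ?PiG0 ?PpG0.
- by rewrite !mulr_ge0 ?PiG0 ?exprn_ge0 ?(ltW lam_gt0).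
by apply: eq_esum => x _; rewrite -!EFinM exprS; congr (_%:E); ring.
Qed.

Lemma occ_walks k J : ((lam ^+ k)%:E * occ k J
  = \esum_(p in walks_to k J) (rho p.1 * walk_weight p.1 p.2)%:E)%E.
Proof.
rewrite -esumZl ?exprn_ge0 ?(ltW lam_gt0)//; last first.
  by move=> y _; apply: esum_ge0 => x _; rewrite lee_fin !mulr_ge0 ?PpG0.
under eq_esum do rewrite occ1_walks.
rewrite esum_esum; last first.
  by move=> y p _ _; rewrite lee_fin !mulr_ge0 ?walk_weight_ge0.
rewrite [RHS](reindex_esum (J `*`` (fun y => walks_to k [set y])) _ snd)//.
split=> [[y [x s]] /= [Jy [/= sk ly]]|[y1 [x1 s1]] [y2 [x2 s2]]|[x s] [/= ss ls]].
- by split=> //=; rewrite ly.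
- by rewrite !inE /= => -[_ [_ /= <-]] [_ [_ /= <-]] [-> ->].
- by exists (last x s, (x, s)).
Qed.

Lemma occ_ge0 k J : (0 <= occ k J)%E.
Proof.
by apply: esum_ge0 => y _; apply: esum_ge0 => x _; rewrite lee_fin !mulr_ge0 ?PpG0.
Qed.

Lemma occ_le1 k J : (occ k J <= 1)%E.
Proof.
apply: le_trans (@subset_esum _ _ J [set: I] _ _ _) _ => //.
  by move=> y _; apply: esum_ge0 => x _; rewrite lee_fin !mulr_ge0 ?PpG0.
rewrite esum_swap => [|? ? _ _]; last by rewrite lee_fin !mulr_ge0 ?PpG0.
rewrite -esum_rho; apply: le_esum => x _.
under eq_esum do rewrite EFinM.
rewrite esumZl// ?(esum_Pi_pow q rho)// ?mule1// => y _; rewrite lee_fin PpG0//.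
Qed.

(** A walk of nonzero weight into [J] would, once its holding steps are deleted, be a path of length
    at most [k]. *)
Lemma occ_eq0 k J : (forall k', (k' <= k)%N -> ~ reachable_in q k' (supp rho) J) ->
  occ k J = 0%E.
Proof.
move=> nr; have : ((lam ^+ k)%:E * occ k J = 0)%E.
  rewrite occ_walks esum1// => -[x s] /= [/= sk Jl]; congr (_%:E).
  have [->|rx] := eqVneq (rho x) 0; first by rewrite mul0r.
  have [->|/walk_path[s' [p1 l1 le1 _]]] := eqVneq (walk_weight x s) 0; first by rewrite mulr0.
  exfalso; apply: (nr (size s')); first by rewrite -sk.
  exists x, s'; split=> //; split=> //; split; last by rewrite l1.
  by rewrite /supp /= lt_neqAle eq_sym rx rho_ge0.
by move/eqP; rewrite mule_eq0 eqe expf_eq0 (gt_eqF lam_gt0) andbF => /eqP.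
Qed.

(** At the minimal length a walk with a nonzero term has no holding step, since deleting one would
    give a shorter path. The surviving walks are therefore exactly the minimal paths. *)
Lemma occ_dmin (J : set I) (d := dmin q (supp rho) J) :
  ((lam ^+ d)%:E * occ d J = (Lambda q rho J)%:E)%E.
Proof.
have e : (\esum_(p in walks_to d J) (rho p.1 * walk_weight p.1 p.2)%:E =
   \esum_(p in [set p : I * seq I | path_between q (dmin q (supp rho) J) (supp rho) J p.1 p.2])
     (rho p.1 * path_weight q p.1 p.2)%:E)%E.
  rewrite esum_mkcond [RHS]esum_mkcond; apply: eq_esum => -[x s] _ /=.
  case: ifPn; rewrite !(inE, notin_setE) /=; last first.
    move=> nw; case: ifPn; rewrite // inE => -[/= sd [_ [_ Jl]]].
    by case: nw; split.
  move=> [/= sd Jl]; case: ifPn; rewrite !(inE, notin_setE) /=.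
    by move=> [_ [p _]]; rewrite walk_weight_path.
  move=> np; congr (_%:E).
  have [->|rx] := eqVneq (rho x) 0; first by rewrite mul0r.
  have sx : supp rho x by rewrite /supp /= lt_neqAle eq_sym rx rho_ge0.
  have [->|/walk_path[s' [p1 l1 le1 pe]]] := eqVneq (walk_weight x s) 0; first by rewrite mulr0.
  exfalso; apply: np; split=> //; split=> //; apply: pe; apply/eqP.
  rewrite eqn_leq le1 sd; apply: dmin_min; exists x, s'; split=> //; split=> //.
  by rewrite l1.
(* The [fine] in [Lambda] is harmless: the sum equals [lam ^+ d * occ d J], which is at most
   [lam ^+ d]. *)
rewrite occ_walks e /Lambda fineK// -e -occ_walks.
rewrite ge0_fin_numE ?mule_ge0 ?occ_ge0 ?lee_fin ?exprn_ge0 ?(ltW lam_gt0)//.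
apply: (@le_lt_trans _ _ ((lam ^+ d)%:E * 1)%E); last by rewrite mule1 ltry.
by apply: lee_wpmul2l; rewrite ?occ_le1// lee_fin exprn_ge0// ltW.
Qed.

Lemma Lambda_ge0 J : 0 <= Lambda q rho J.
Proof.
by rewrite -lee_fin -occ_dmin mule_ge0 ?occ_ge0// lee_fin exprn_ge0// ltW.
Qed.

Lemma Lambda_gt0 J : (exists k, reachable_in q k (supp rho) J) -> 0 < Lambda q rho J.
Proof.
move=> /dmin_reachable[x [s [sd [p [sx Jl]]]]].
rewrite -lte_fin -occ_dmin occ_walks.
apply: (@lt_le_trans _ _ (rho x * walk_weight x s)%:E).
  by rewrite lte_fin mulr_gt0// walk_weight_path// path_weight_gt0.
apply: (@esum_ge_term _ _ _ (fun p => (rho p.1 * walk_weight p.1 p.2)%:E) (x, s)) => //.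
by move=> p' _; rewrite lee_fin mulr_ge0 ?walk_weight_ge0.
Qed.

Lemma Ptrans_le1 t x y : 0 <= t -> Ptrans q t x y <= 1.
Proof.
move=> t0; rewrite -lee_fin (PtransE q rho)// -(esum_pois (lam * t)) ?(lamt_ge0 q rho)//.
apply: le_esum => k _; rewrite lee_fin -[leRHS]mulr1 ler_wpM2l ?(Pi_pow_le1 q rho)//.
by rewrite pois_ge0 ?(lamt_ge0 q rho).
Qed.

Let PtG0 t x y := Ptrans_ge0 q rho qgen qbnd rhoP t x y.

Lemma fdd1E t y : 0 <= t ->
  ((fdd q rho [:: (t, y)])%:E = \esum_(x in [set: I]) (rho x * Ptrans q t x y)%:E)%E.
Proof.
move=> t0; rewrite /= mulr1 fineK// ge0_fin_numE; last first.
  by apply: esum_ge0 => x _; rewrite lee_fin mulr_ge0 ?PtG0.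
apply: le_lt_trans (ltry 1); rewrite -esum_rho; apply: le_esum => x _.
by rewrite lee_fin -[leRHS]mulr1 ler_wpM2l ?Ptrans_le1.
Qed.

(** Stated through the finite-dimensional laws only, so that it can be estimated without reference
    to a probability space; [occ_probP] identifies it with the probability of an event. *)
Definition occ_prob t (J : set I) : \bar R :=
  (\esum_(y in J) (fdd q rho [:: (t, y)])%:E)%E.

(** This conditions on the number of rings of the Poisson clock before [t]; all sums are nonnegative
    and may be interchanged. *)
Lemma occ_probE t J : 0 <= t ->
  (occ_prob t J = \esum_(k in [set: nat]) ((pois (lam * t) k)%:E * occ k J))%E.
Proof.
move=> t0; have lt0 : 0 <= lam * t by rewrite (lamt_ge0 q rho).
transitivity (\esum_(y in J) \esum_(k in [set: nat]) \esum_(x in [set: I])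
   ((pois (lam * t) k)%:E * (rho x * Pi_pow q k x y)%:E))%E.
  apply: eq_esum => y _; rewrite fdd1E//.
  rewrite esum_swap => [|? ? _ _]; last by rewrite -EFinM lee_fin mulr_ge0 ?pois_ge0// mulr_ge0 ?PpG0.
  apply: eq_esum => x _; rewrite EFinM (PtransE q rho)// -esumZl//.
    by apply: eq_esum => k _; rewrite -!EFinM mulrCA.
  by move=> k _; rewrite lee_fin mulr_ge0 ?pois_ge0 ?PpG0.
rewrite esum_swap => [|y k _ _]; last first.
  by apply: esum_ge0 => x _; rewrite -EFinM lee_fin mulr_ge0 ?pois_ge0// mulr_ge0 ?PpG0.
apply: eq_esum => k _; rewrite -esumZl ?pois_ge0//; last first.
  by move=> y _; apply: esum_ge0 => x _; rewrite lee_fin !mulr_ge0 ?PpG0.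
apply: eq_esum => y _; rewrite esumZl ?pois_ge0//.
by move=> x _; rewrite lee_fin !mulr_ge0 ?PpG0.
Qed.

Lemma occ_prob_unreachable t J : 0 <= t ->
  ~ (exists k, reachable_in q k (supp rho) J) -> occ_prob t J = 0%E.
Proof.
move=> t0 nr; rewrite occ_probE// esum1// => k _; rewrite occ_eq0 ?mule0// => k' _ ?.
by apply: nr; exists k'.
Qed.

Lemma pois_occ_dmin t J (d := dmin q (supp rho) J) : 0 <= t ->
  ((pois (lam * t) d)%:E * occ d J =
   (expR (- (lam * t)) * (Lambda q rho J * t ^+ d / (d`!)%:R))%:E)%E.
Proof.
move=> t0.
transitivity ((expR (- (lam * t)) * t ^+ d / (d`!)%:R)%:E * ((lam ^+ d)%:E * occ d J))%E.
  by rewrite muleA -EFinM; congr (_%:E * _)%E; rewrite /pois exprMn; ring.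
by rewrite occ_dmin -EFinM; congr (_%:E); ring.
Qed.

(** Only the Poisson term of index [d] is kept. *)
Lemma occ_prob_ge t J (d := dmin q (supp rho) J) : 0 <= t ->
  ((expR (- (lam * t)) * (Lambda q rho J * t ^+ d / (d`!)%:R))%:E <= occ_prob t J)%E.
Proof.
move=> t0; rewrite -pois_occ_dmin// occ_probE//.
apply: (@esum_ge_term _ _ _ (fun k => (pois (lam * t) k)%:E * occ k J)%E d) => // k _.
by rewrite mule_ge0 ?occ_ge0// lee_fin pois_ge0 ?(lamt_ge0 q rho).
Qed.

(** Terms of index below [d] vanish, the term [d] is the leading one, and the rest is bounded by the
    Poisson tail from [d.+1] on. *)
Lemma occ_prob_le t J (d := dmin q (supp rho) J) : 0 <= t ->
  (occ_prob t J <= (Lambda q rho J * t ^+ d / (d`!)%:R + (lam * t) ^+ d.+1)%:E)%E.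
Proof.
move=> t0; have lt0 : 0 <= lam * t by rewrite (lamt_ge0 q rho).
have pg k : (0 <= (pois (lam * t) k)%:E * occ k J)%E.
  by rewrite mule_ge0 ?occ_ge0// lee_fin pois_ge0.
rewrite occ_probE// (esumID [set k | (d.+1 <= k)%N])// addeC EFinD; apply: leeD.
  rewrite setTI (@esum_single _ _ _ _ d) /= ?ltnn//; last first.
    move=> k /= /negP; rewrite -leqNgt => kd kd'; rewrite occ_eq0 ?mule0// => k' k'k /dmin_min.
    by apply/negP; rewrite -ltnNge (leq_ltn_trans k'k)// ltn_neqAle kd'.
  rewrite pois_occ_dmin// lee_fin ler_piMl ?expR_le1 ?oppr_le0//.
  by rewrite !mulr_ge0 ?Lambda_ge0 ?exprn_ge0// invr_ge0.
rewrite setTI; apply: le_trans (esum_pois_tail _ _ lt0).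
apply: le_esum => k _; rewrite -[leRHS]mule1; apply: lee_wpmul2l; last exact: occ_le1.
by rewrite lee_fin pois_ge0.
Qed.

End walks.

(** * Finite-dimensional events *)

Section countable_partition.
Context {d : measure_display} {Omega : measurableType d} {R : realType}.
Variables (T : countType).

(** Transports a family to the natural numbers along [pickle], with the empty set at numbers that
    encode nothing, so that sigma-additivity along sequences applies. *)
Let F' (F : T -> set Omega) (k : nat) : set Omega := if choice.unpickle k is Some v then F v else set0.

Let bigcup_pickle (A : set T) (F : T -> set Omega) :
  \bigcup_(v in A) F v = \bigcup_(k in choice.pickle @` A) F' F k.
Proof.
apply/seteqP; split=> [w [v Av Fw]|w [k [v Av <-]]].
  by exists (choice.pickle v); [exists v|rewrite /F' choice.pickleK].
by rewrite /F' choice.pickleK /= => Fw; exists v.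
Qed.

Lemma measurable_bigcup_count (A : set T) (F : T -> set Omega) :
  (forall v, A v -> measurable (F v)) -> measurable (\bigcup_(v in A) F v).
Proof.
move=> mF; rewrite bigcup_pickle; apply: bigcup_measurable => k [v Av <-].
by rewrite /F' choice.pickleK; exact: mF.
Qed.

Lemma measure_bigcup_count (mu : {measure set Omega -> \bar R}) (A : set T) (F : T -> set Omega) :
  (forall v, A v -> measurable (F v)) -> trivIset A F ->
  (mu (\bigcup_(v in A) F v) = \esum_(v in A) mu (F v))%E.
Proof.
move=> mF tF; rewrite bigcup_pickle measure_bigcup; last 2 first.
- by move=> k [v Av <-]; rewrite /F' choice.pickleK; exact: mF.
- move=> k l [v Av <-] [v' Av' <-]; rewrite /F' !choice.pickleK /= => vv'.
  by congr (choice.pickle _); exact: tF.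
rewrite nneseries_esum//.
rewrite (_ : [set x | x \in choice.pickle @` A] = choice.pickle @` A); last first.
  by apply/seteqP; split=> k /=; rewrite inE.
rewrite esum_image; last by move=> v v' _ _; exact: (pcan_inj choice.pickleK).
by apply: eq_esum => v _; rewrite /F' choice.pickleK.
Qed.

End countable_partition.

(** * Joint observations of the searchers at finitely many times *)

Section observations.
Context {R : realType} {I : countType} {d : measure_display} {Omega : measurableType d}.
Variables (q : I -> I -> R) (rho : I -> R) (P : probability Omega R).
Variable (X : nat -> Omega -> R -> I).
Hypothesis qgen : is_generator q.
Hypothesis qbnd : bounded_rates q.
Hypothesis rhoP : is_distribution rho.
Hypothesis Xiid : iid_CTMC q rho P X.
Local Notation lam := (unif_rate q).

Definition obs (n : nat) (ts : seq R) (w : Omega) : seq I := [seq X n w t | t <- ts].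

Definition times (ts : seq R) : bool := all (fun t => 0 <= t) ts && sorted <=%R ts.

Lemma times_subseq ts ts' : subseq ts ts' -> times ts' -> times ts.
Proof.
move=> s /andP[a b]; rewrite /times (subseq_sorted _ s b) ?andbT; last exact: le_trans.
by apply/allP => t /(mem_subseq s); apply: (allP a).
Qed.

Let admissible_zip ts (v : seq I) : times ts -> size v = size ts ->
  admissible_times (zip ts v).
Proof.
move=> /andP[a b] sv; have e : ts = map fst (zip ts v) by rewrite -/unzip1 unzip1_zip ?sv.
move: a b; rewrite [in X in X -> _]e [in X in _ -> X -> _]e all_map sorted_map => a b.
by rewrite /admissible_times; apply/andP; split.
Qed.

Lemma measurable_obs1 n ts v : measurable [set w | obs n ts w = v].
Proof.
elim: ts v => [|t ts IH] [|x v] /=.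
- by rewrite (_ : [set _ | _] = setT)//; apply/seteqP; split.
- by rewrite (_ : [set _ | _] = set0)//; apply/seteqP; split.
- by rewrite (_ : [set _ | _] = set0)//; apply/seteqP; split.
rewrite (_ : [set _ | _] = [set w | X n w t = x] `&` [set w | obs n ts w = v]).
  by apply: measurableI => //; case: Xiid => mX _; exact: mX.
by apply/seteqP; split=> w /= => [[-> <-]|[<- <-]].
Qed.

(** Observation vectors range over a countable type, so an arbitrary [A] is a countable union of
    single vectors. *)
Lemma measurable_obs n ts (A : set (seq I)) : measurable [set w | A (obs n ts w)].
Proof.
rewrite (_ : [set _ | _] = \bigcup_(v in A) [set w | obs n ts w = v]).
  by apply: measurable_bigcup_count => // v _; exact: measurable_obs1.
by apply/seteqP; split=> [w Aw|w [v Av /= ->]]//; exists (obs n ts w).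
Qed.

Let obs_match n ts v w : size v = size ts ->
  all (fun p => X n w p.1 == p.2) (zip ts v) <-> obs n ts w = v.
Proof.
elim: ts v => [|t ts IH] [|x v]//= [sv]; split.
  by move=> /andP[/eqP-> /IH ->].
by move=> [-> e]; rewrite eqxx; apply/IH.
Qed.

Let match_all (ss : seq (seq (R * I))) N (w : Omega) : Prop :=
  forall n, (n < size ss)%N -> all (fun p => X (N + n)%N w p.1 == p.2) (nth [::] ss n).

Let measurable_match (s : seq (R * I)) n :
  measurable [set w | all (fun p => X n w p.1 == p.2) s].
Proof.
rewrite (_ : [set _ | _] = [set w | obs n (unzip1 s) w = unzip2 s]).
  exact: measurable_obs1.
apply/seteqP; split=> w /=; rewrite -obs_match ?size_map// zip_unzip//.
Qed.

(** The first [N] searchers satisfy the condition [A], and the searchers [N], [N + 1], ... follow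
    the trajectories listed in [ss]. This mixed form is what allows an induction on [N]. *)
Let ev (ts : seq R) (A : set (seq I)) N ss : set Omega :=
  [set w | (forall n, (n < N)%N -> A (obs n ts w)) /\ match_all ss N w].

Let measurable_ev ts A N ss : measurable (ev ts A N ss).
Proof.
rewrite (_ : ev _ _ _ _ = \bigcap_(n < N) [set w | A (obs n ts w)] `&`
   \bigcap_(n < size ss) [set w | all (fun p => X (N + n)%N w p.1 == p.2) (nth [::] ss n)]).
  apply: measurableI; apply: bigcap_measurableType => // n _; first exact: measurable_obs.
by apply/seteqP; split=> w [].
Qed.

Lemma obs_law ts v : times ts -> size v = size ts ->
  P [set w | obs 0 ts w = v] = (fdd q rho (zip ts v))%:E.
Proof.
move=> tts sv; case: Xiid => _ [_ /(_ [:: zip ts v])].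
rewrite big_seq1 /= andbT => <-; last exact: admissible_zip.
congr (P _); apply/seteqP; split=> w /=; rewrite -obs_match//.
  by move=> ? [].
by move=> /(_ 0%N); apply.
Qed.

Let obs_lawA ts (A : set (seq I)) : times ts ->
  (P [set w | A (obs 0 ts w)] =
  \esum_(v in A `&` [set v | size v = size ts]) (fdd q rho (zip ts v))%:E)%E.
Proof.
move=> tts; transitivity
  (\esum_(v in A `&` [set v | size v = size ts]) P [set w | obs 0 ts w = v]); last first.
  by apply: eq_esum => v [_ ?]; rewrite obs_law.
rewrite -measure_bigcup_count.
- congr (P _); apply/seteqP; split=> [w Aw|w [v [Av _] /= ->]]//.
  by exists (obs 0 ts w) => //; split=> //=; rewrite size_map.
- by move=> v _; exact: measurable_obs1.
- by move=> v v' _ _ [w [/= <- <-]].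
Qed.

(** The hypothesis gives independence for exact trajectories only. In the induction the condition on
    the last constrained searcher is decomposed over its possible observation vectors, each of which
    is moved to the head of [ss]. *)
Let ev_indep ts A N ss : times ts -> all (@admissible_times R I) ss ->
  P (ev ts A N ss) =
  ((fine (P [set w | A (obs 0 ts w)])) ^+ N * \prod_(s <- ss) fdd q rho s)%:E.
Proof.
move=> tts; elim: N ss => [|N IH] ss ass.
  rewrite expr0 mul1r; case: Xiid => _ [_ <-//]; congr (P _).
  by apply/seteqP; split=> w /= => [[]//|h]; split.
set p := fine _.
have pE : p%:E = P [set w | A (obs 0 ts w)].
  by rewrite fineK// fin_num_measure//; exact: measurable_obs.
have fdd_ge0 v : size v = size ts -> (0 <= (fdd q rho (zip ts v))%:E)%E.
  by move=> sv; rewrite -obs_law.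
have aZ v : size v = size ts -> all (@admissible_times R I) (zip ts v :: ss).
  by move=> sv; rewrite /= admissible_zip.
have prod_ge0 : 0 <= p ^+ N * \prod_(s <- ss) fdd q rho s.
  by rewrite -lee_fin -IH.
transitivity (\esum_(v in A `&` [set v | size v = size ts]) P (ev ts A N (zip ts v :: ss))).
  rewrite -measure_bigcup_count.
  - congr (P _); apply/seteqP; split=> [w [Aw mw]|w [v [Av sv] [Aw mw]]].
      exists (obs N ts w); first by split; [exact: Aw|rewrite /= size_map].
      split=> [n nN|]; first by apply: Aw; exact: ltnW.
      move=> [_|n /=]; first by rewrite addn0; apply/obs_match; rewrite ?size_map.
      by rewrite ltnS addnS => /mw.
    split=> [n|n ns]; last by have := mw n.+1; rewrite /= ltnS addnS; apply.
    rewrite ltnS leq_eqVlt => /predU1P[->|]; last exact: Aw.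
    by have := mw 0%N isT; rewrite addn0 => /obs_match -> .
  - by move=> v _; exact: measurable_ev.
  - move=> v v' [_ /= sv] [_ /= sv'] [w [[_ /(_ 0%N isT) /= +] [_ /(_ 0%N isT) /=]]].
    by rewrite addn0 => /obs_match <- // /obs_match <-.
transitivity (\esum_(v in A `&` [set v | size v = size ts])
   ((p ^+ N * \prod_(s <- ss) fdd q rho s)%:E * (fdd q rho (zip ts v))%:E)%E).
  apply: eq_esum => v [_ sv]; rewrite IH ?aZ// big_cons -EFinM; congr (_%:E).
  by rewrite -/p; ring.
rewrite esumZl//; last by move=> v [_ ?]; exact: fdd_ge0.
by rewrite -obs_lawA// -pE -EFinM; congr (_%:E); rewrite exprS; ring.
Qed.

Lemma obs_indep ts (A : set (seq I)) N : times ts ->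
  P [set w | forall n, (n < N)%N -> A (obs n ts w)] =
  ((fine (P [set w | A (obs 0 ts w)])) ^+ N)%:E.
Proof.
move=> tts; have := @ev_indep ts A N [::] tts isT.
rewrite big_nil mulr1 => <-; congr (P _); apply/seteqP; split=> [w Aw|w []//].
by split.
Qed.

Let rcons_zip (ts : seq R) (v : seq I) t x : size v = size ts ->
  zip (rcons ts t) (rcons v x) = rcons (zip ts v) (t, x).
Proof. by move=> sv; rewrite -!cats1 zip_cat ?sv. Qed.

Let chain_prob_rcons t i s u x :
  chain_prob q t i (rcons s (u, x)) =
  chain_prob q t i s * Ptrans q (u - (last (t, i) s).1) (last (t, i) s).2 x.
Proof.
elim: s t i => [|[t' j] s IH] t i /=; first by rewrite mulrC.
by rewrite IH mulrA.
Qed.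

Let fdd_rcons2 s t x u y :
  fdd q rho (rcons (rcons s (t, x)) (u, y)) =
  fdd q rho (rcons s (t, x)) * Ptrans q (u - t) x y.
Proof.
case: s => [|[t' j] s] /=; first by rewrite !mulr1.
by rewrite chain_prob_rcons last_rcons mulrA.
Qed.

(** The chain sits in some [j] of [J] at time [u], and it is again at [j] at time [t] with
    probability [Ptrans (t - u) j j], at least exp(-lam (t - u)) and hence at least exp(-lam t). *)
Let markov_last ts u t (A : set (seq I)) (J : set I) :
  times (rcons (rcons ts u) t) -> (forall v j, A (rcons v j) -> J j) ->
  ((expR (- (lam * t)))%:E * P [set w | A (obs 0 (rcons ts u) w)] <=
   P [set w | A (obs 0 (rcons ts u) w) /\ J (X 0 w t)])%E.
Proof.
move=> tts AJ.
have tts1 : times (rcons ts u) by apply: times_subseq tts; exact: subseq_rcons.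
have [u0 ut] : 0 <= u /\ u <= t.
  have : times [:: u; t].
    apply: times_subseq tts; rewrite -!cats1 -catA.
    exact: cat_subseq (sub0seq ts) (subseq_refl [:: u; t]).
  by rewrite /times /= !andbT => /andP[/andP[? _] ?].
have fdd_ge0 ts' v : times ts' -> size v = size ts' -> (0 <= (fdd q rho (zip ts' v))%:E)%E.
  by move=> tts' sv; rewrite -obs_law.
pose D := [set p : seq I * I | A (rcons p.1 p.2) /\ size p.1 = size ts].
(* Observation vectors whose state at [u] is repeated at [t]. *)
pose B := [set rcons (rcons p.1 p.2) p.2 | p in D].
apply: (@le_trans _ _ (P [set w | B (obs 0 (rcons (rcons ts u) t) w)])); last first.
  apply: le_measure; rewrite ?inE; first exact: measurable_obs.
    rewrite (_ : [set _ | _] = [set w | A (obs 0 (rcons ts u) w)] `&`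
       [set w | [set v | exists j, v = [:: j] /\ J j] (obs 0 [:: t] w)]).
      by apply: measurableI; exact: measurable_obs.
    by apply/seteqP; split=> w /= [? h]; split=> //;[exists (X 0 w t)|case: h => j [[->]]].
  move=> w [[v j] [/= Av sv]]; rewrite /obs map_rcons => /rcons_inj[e <-].
  by split=> /=; [rewrite /obs -e|exact: AJ Av].
rewrite !obs_lawA//.
have -> : A `&` [set v | size v = size (rcons ts u)] = (fun p => rcons p.1 p.2) @` D.
  apply/seteqP; split=> [v [Av /=]|_ [[v j] [/= Av sv] <-]]; last first.
    by split=> //=; rewrite !size_rcons sv.
  case/lastP: v Av => [|v j] Av; rewrite !size_rcons // => -[sv].
  by exists (v, j).
have -> : B `&` [set v | size v = size (rcons (rcons ts u) t)] =
    (fun p => rcons (rcons p.1 p.2) p.2) @` D.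
  by apply/seteqP; split=> [_ [[p Dp <-] _]|_ [p Dp <-]]; [exists p|split; [exists p|
     rewrite /= !size_rcons; case: Dp => _ ->]].
rewrite !esum_image; last 2 first.
- by move=> [v j] [v' j'] _ _ /= /rcons_inj[/rcons_inj[-> ->]].
- by move=> [v j] [v' j'] _ _ /= /rcons_inj[-> ->].
rewrite -esumZl ?expR_ge0//; last first.
  by move=> [v j] [_ /= sv]; apply: fdd_ge0; rewrite ?size_rcons ?sv.
apply: le_esum => -[v j] [/= Av sv].
have ge0 : 0 <= fdd q rho (rcons (zip ts v) (u, j)).
  by rewrite -rcons_zip// -lee_fin; apply: fdd_ge0; rewrite ?size_rcons ?sv.
rewrite !rcons_zip ?size_rcons ?sv// fdd_rcons2 -EFinM lee_fin mulrC.
apply: ler_wpM2l => //; apply: le_trans (Ptrans_diag_ge q rho _ _ _ _ _ _) => //; last by rewrite subr_ge0.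
by rewrite ler_expR lerN2 ler_wpM2l ?(ltW (unif_rate_gt0 q rho _ _))// lerBlDr lerDl.
Qed.

(** Decomposition at the first observed entrance into [J]: the induction over [us] splits on whether
    the next time [u] sees [J] ([A1]) or not ([A2]). The past event [A] is carried along to record
    the failures so far. *)
Let hit_le_past ts us t (A : set (seq I)) (J : set I) : times (ts ++ us ++ [:: t]) ->
  ((expR (- (lam * t)))%:E *
     P [set w | A (obs 0 ts w) /\ exists2 u, u \in us & J (X 0 w u)] <=
   P [set w | A (obs 0 ts w) /\ J (X 0 w t)])%E.
Proof.
have mE (ts' us' : seq R) (A' : set (seq I)) :
    measurable [set w | A' (obs 0 ts' w) /\ exists2 u, u \in us' & J (X 0 w u)].
  rewrite (_ : [set _ | _] = [set w | A' (obs 0 ts' w)] `&`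
       [set w | [set v : seq I | exists2 j, j \in v & J j] (obs 0 us' w)]).
    by apply: measurableI; exact: measurable_obs.
  apply/seteqP; split=> w /= [? [x]].
    by move=> xu Jx; split=> //; exists (X 0 w x) => //; exact: map_f.
  by move=> /mapP[u uu ->] Ju; split=> //; exists u.
have mJ ts' (A' : set (seq I)) t' : measurable [set w | A' (obs 0 ts' w) /\ J (X 0 w t')].
  have := mE ts' [:: t'] A'; congr measurable; apply/seteqP; split=> w /= [? h]; split=> //.
    by case: h => u; rewrite inE => /eqP ->.
  by exists t'; rewrite ?inE.
elim: us ts A => [|u us IH] ts A tts.
  rewrite [X in P X](_ : _ = set0) ?measure0 ?mule0//.
  by apply/seteqP; split=> w //= [_ [u]].
pose A1 := [set rcons p.1 p.2 | p in [set p : seq I * I | A p.1 /\ J p.2]].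
pose A2 := [set rcons p.1 p.2 | p in [set p : seq I * I | A p.1 /\ ~ J p.2]].
have A1E w : A1 (obs 0 (rcons ts u) w) <-> A (obs 0 ts w) /\ J (X 0 w u).
  rewrite /obs map_rcons; split=> [[[v j] [/= ? ?] /rcons_inj[<- <-]]//|?].
  by exists (obs 0 ts w, X 0 w u).
have A2E w : A2 (obs 0 (rcons ts u) w) <-> A (obs 0 ts w) /\ ~ J (X 0 w u).
  rewrite /obs map_rcons; split=> [[[v j] [/= ? ?] /rcons_inj[<- <-]]//|?].
  by exists (obs 0 ts w, X 0 w u).
have -> : [set w | A (obs 0 ts w) /\ exists2 u', u' \in u :: us & J (X 0 w u')] =
   [set w | A1 (obs 0 (rcons ts u) w)] `|`
   [set w | A2 (obs 0 (rcons ts u) w) /\ exists2 u', u' \in us & J (X 0 w u')].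
  apply/seteqP; split=> w /=; rewrite A1E A2E.
    move=> [Aw [u']]; rewrite inE => /predU1P[->|u'us] Ju'; first by left.
    by have [Ju|Ju] := pselect (J (X 0 w u)); [left|right; split=> //; exists u'].
  case=> [[? ?]|[[? ?] [u' ? ?]]]; split=> //; first by exists u; rewrite ?inE ?eqxx.
  by exists u'; rewrite // inE orbC; apply/orP; left.
rewrite measureU//; last 2 first.
- exact: measurable_obs.
- by apply/seteqP; split=> w //= []; rewrite A1E A2E => -[_ Ju] [[_ /(_ Ju)]].
rewrite ge0_muleDr//.
have -> : [set w | A (obs 0 ts w) /\ J (X 0 w t)] =
   [set w | A1 (obs 0 (rcons ts u) w) /\ J (X 0 w t)] `|`
   [set w | A2 (obs 0 (rcons ts u) w) /\ J (X 0 w t)].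
  apply/seteqP; split=> w /=; rewrite A1E A2E; last by case=> -[[? ?] ?].
  by move=> [? ?]; have [Ju|Ju] := pselect (J (X 0 w u)); [left|right].
rewrite measureU//; last first.
  by apply/seteqP; split=> w //= []; rewrite A1E A2E => -[[_ Ju] _] [[_ /(_ Ju)]].
apply: leeD.
  apply: markov_last; last by move=> v j [[v' j'] [/= _ Jj] /rcons_inj[_ <-]].
  apply: times_subseq tts; rewrite -[u :: us]cat1s -[in X in subseq X]cats1 -cats1 -!catA.
  apply: cat_subseq => //=; rewrite eqxx; exact: suffix_subseq.
by apply: IH; rewrite cat_rcons.
Qed.

Lemma occ_probP t (J : set I) : 0 <= t -> P [set w | J (X 0 w t)] = occ_prob q rho t J.
Proof.
move=> t0; have tt : times [:: t] by rewrite /times /= t0.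
have := obs_lawA [:: t] [set v | exists j, v = [:: j] /\ J j] tt.
rewrite (_ : [set w | [set v | _] _] = [set w | J (X 0 w t)]); last first.
  by apply/seteqP; split=> [w [j [[<-]]]|w Jw]//=; exists (X 0 w t).
move=> ->; rewrite (_ : _ `&` _ = (fun j => [:: j]) @` J).
  by rewrite esum_image// => i j _ _ [].
by apply/seteqP; split=> [v [[j [-> ?] _]]|_ [j ? <-]]; [exists j|split=> //; exists j].
Qed.

Lemma hit_le us t (J : set I) : times (rcons us t) ->
  ((expR (- (lam * t)))%:E * P [set w | exists2 u, u \in us & J (X 0 w u)] <=
   occ_prob q rho t J)%E.
Proof.
move=> tus; have t0 : 0 <= t.
  by move: tus; rewrite /times all_rcons => /andP[/andP[]].
have := @hit_le_past [::] us t setT J; rewrite cats1 => /(_ tus).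
rewrite -occ_probP//; congr (_ * P _ <= P _)%E; apply/seteqP; split=> w //= -[]//.
Qed.

End observations.

(** * Survival probabilities *)

Lemma cvgr_exprn {R : realType} {T : Type} (F : set_system T) {FF : Filter F} (f : T -> R) (a : R) n :
  f @ F --> a -> f x ^+ n @[x --> F] --> a ^+ n.
Proof. by move=> fa; exact: (@continuous_cvg _ _ _ F FF f (fun x : R => x ^+ n) a (@exprn_continuous R n a) fa). Qed.

Lemma cvgr_comp_expR {R : realType} {T : Type} (F : set_system T) {FF : Filter F} (f : T -> R) (a : R) :
  f @ F --> a -> expR (f x) @[x --> F] --> expR a.
Proof. by move=> fa; exact: (cvg_comp _ _ fa (@continuous_expR R a)). Qed.

Section survival.
Context {R : realType} {I : countType} {d : measure_display} {Omega : measurableType d}.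
Variables (q : I -> I -> R) (rho : I -> R) (P : probability Omega R).
Variable (X : nat -> Omega -> R -> I).
Hypothesis qgen : is_generator q.
Hypothesis qbnd : bounded_rates q.
Hypothesis rhoP : is_distribution rho.
Hypothesis Xiid : iid_CTMC q rho P X.
Local Notation lam := (unif_rate q).

(** The time interval is open at [t], so that these events describe exactly [t <= cover_time] and
    [t <= first_hit]. *)
Definition avoid (N : nat) (J : set I) (t : R) : set Omega :=
  [set w | forall n, (n < N)%N -> forall s, 0 <= s < t -> ~ J (X n w s)].

Definition survival (J : set I) (t : R) : R := fine (P (avoid 1 J t)).

(* The first k rationals, restricted to ]0, t[, in increasing order. *)
Definition mesh (t : R) (k : nat) : seq R :=
  sort <=%R [seq s <- [seq ratr r | r <- pmap (@choice.unpickle rat) (iota 0 k)] | 0 < s < t].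

Let mem_mesh t k s : s \in mesh t k ->  0 < s < t.
Proof. by rewrite mem_sort mem_filter => /andP[]. Qed.

Let mesh_times t k : 0 <= t -> times (rcons (mesh t k) t).
Proof.
move=> t0; rewrite /times all_rcons t0 /=; apply/andP; split.
  by apply/allP => s /mem_mesh /andP[/ltW].
have ss : sorted <=%R (mesh t k) by apply: sort_sorted; exact: le_total.
case e : (mesh t k) ss => [|s0 s]//=; rewrite rcons_path => -> /=.
by have /mem_mesh/andP[_ /ltW] : last s0 s \in mesh t k by rewrite e mem_last.
Qed.

Let mesh_mono t k l : (k <= l)%N -> {subset mesh t k <= mesh t l}.
Proof.
move=> kl s; rewrite !mem_sort !mem_filter => /andP[-> /=] /mapP[r rk ->].
apply: map_f; move: rk; rewrite !mem_pmap => /mapP[i ik ->]; apply: map_f.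
by move: ik; rewrite !mem_iota /= !add0n => /leq_trans; apply.
Qed.

Let mesh_rat t (r : rat) : 0 < (ratr r : R) < t -> exists k, (ratr r : R) \in mesh t k.
Proof.
move=> rt; exists (choice.pickle r).+1; rewrite mem_sort mem_filter rt andTb; apply: map_f.
by rewrite mem_pmap -(choice.pickleK r); apply: map_f; rewrite mem_iota add0n ltnSn.
Qed.

(* Right-constancy of the paths reduces [0, t[ to its rational points. *)
Let path_rat n w t (J : set I) s : 0 <= s < t -> J (X n w s) ->
  exists r : rat, 0 < (ratr r : R) < t /\ J (X n w (ratr r)).
Proof.
move=> /andP[s0 st] Js; case: Xiid => _ [/(_ n w s s0)[e e0 he] _].
have [r] : exists r : rat, (ratr r : R) \in `]s, (Num.min (s + e) t)[.
  by apply: rat_in_itvoo; rewrite lt_min st ltrDl e0.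
rewrite in_itv /= lt_min => /and3P[sr re rt]; exists r; split.
  by rewrite rt (le_lt_trans s0 sr).
by rewrite he// re (ltW sr).
Qed.

Let mesh_avoid N J t k : set Omega :=
  [set w | forall n, (n < N)%N -> [set v : seq I | forall j, j \in v -> ~ J j] (obs X n (mesh t k) w)].

Let avoid_bigcap N J t : avoid N J t = \bigcap_k mesh_avoid N J t k.
Proof.
apply/seteqP; split=> [w h k _ n nN /= j /mapP[s /mem_mesh/andP[s0 st] ->]|w h n nN s st Js].
  by apply: h => //; rewrite ltW.
have [r [/mesh_rat[k rk] Jr]] := path_rat _ _ _ _ _ st Js.
by apply: (h k Logic.I n nN) Jr; exact: map_f.
Qed.

Let measurable_mesh_avoid N J t k : measurable (mesh_avoid N J t k).
Proof.
rewrite (_ : mesh_avoid _ _ _ _ = \bigcap_(n in `I_N)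
  [set w | [set v : seq I | forall j, j \in v -> ~ J j] (obs X n (mesh t k) w)])//.
apply: bigcap_measurableType => n _.
exact: (measurable_obs q rho P X Xiid n (mesh t k)).
Qed.

Lemma measurable_avoid N J t : measurable (avoid N J t).
Proof. by rewrite avoid_bigcap; exact: bigcapT_measurable. Qed.

(** Refining the mesh gives decreasing events with intersection [avoid N J t], so continuity from
    above applies. *)
Let cvg_mesh_avoid N J t : P (mesh_avoid N J t k) @[k --> \oo] --> P (avoid N J t).
Proof.
rewrite avoid_bigcap; apply: nonincreasing_cvg_mu => //.
- by rewrite (le_lt_trans (probability_le1 _ _)) ?ltry.
- exact: bigcapT_measurable.
- move=> k l kl; apply/subsetPset => w h n nN /= j /mapP[s sk ->]; apply: (h n nN) => //.
  by apply: map_f; exact: mesh_mono sk.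
Qed.

Let mesh1 J t k : mesh_avoid 1 J t k =
  [set w | [set v : seq I | forall j, j \in v -> ~ J j] (obs X 0 (mesh t k) w)].
Proof. by apply/seteqP; split=> [w /(_ 0%N isT)|w h n]//; rewrite ltnS leqn0 => /eqP ->. Qed.

Lemma survivalE J t : P (avoid 1 J t) = (survival J t)%:E.
Proof. by rewrite /survival fineK// fin_num_measure//; exact: measurable_avoid. Qed.

Let cvg_survival J t : fine (P (mesh_avoid 1 J t k)) @[k --> \oo] --> survival J t.
Proof.
by apply: fine_cvg; rewrite -survivalE; exact: cvg_mesh_avoid.
Qed.

Lemma survival_ge0 J t : 0 <= survival J t.
Proof. exact: fine_ge0. Qed.

Lemma survival_le1 J t : survival J t <= 1.
Proof. by rewrite -lee_fin -survivalE probability_le1//; exact: measurable_avoid. Qed.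

(** Independence holds on every finite mesh by [obs_indep], and both sides converge as the mesh is
    refined. *)
Lemma avoid_indep N J t : 0 <= t -> P (avoid N J t) = (survival J t ^+ N)%:E.
Proof.
move=> t0; apply: (cvg_unique _ (cvg_mesh_avoid N J t)) => //.
rewrite (_ : (fun k => _) = EFin \o (fun k => fine (P (mesh_avoid 1 J t k)) ^+ N)).
  by apply: cvg_EFin; [exact: nearW|apply: cvgr_exprn; exact: cvg_survival].
apply/funext => k /=; rewrite mesh1 -(obs_indep q rho P X Xiid)//.
by apply: times_subseq (mesh_times t k t0); exact: subseq_rcons.
Qed.

Lemma survival_le J s t : s <= t -> survival J t <= survival J s.
Proof.
move=> st; rewrite -lee_fin -!survivalE; apply: le_measure; rewrite ?inE; try exact: measurable_avoid.
move=> w h n nN u /andP[u0 us]; apply: h => //; first by rewrite u0 (lt_le_trans us st).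
Qed.

Lemma survival_antitone (A B : set I) t : A `<=` B -> survival B t <= survival A t.
Proof.
move=> AB; rewrite -lee_fin -!survivalE; apply: le_measure; rewrite ?inE; try exact: measurable_avoid.
by move=> w h n nN u /h + /AB; exact.
Qed.

(** The entrance-time bound [hit_le] holds for every mesh with a right side free of the mesh, so it
    survives the limit. *)
Lemma survival_ge J t : 0 <= t ->
  ((expR (- (lam * t)))%:E * (1 - survival J t)%:E <= occ_prob q rho t J)%E.
Proof.
move=> t0.
have h k : ((expR (- (lam * t)) * (1 - fine (P (mesh_avoid 1 J t k))))%:E
    <= occ_prob q rho t J)%E.
  apply: le_trans (hit_le q rho P X qgen qbnd rhoP Xiid (mesh t k) t J (mesh_times t k t0)).
  rewrite EFinM EFinB fineK ?fin_num_measure//; apply: lee_wpmul2l; first by rewrite lee_fin expR_ge0.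
  rewrite -probability_setC//; apply: le_measure; rewrite ?inE.
  - by apply: measurableC.
  - have := measurable_obs q rho P X Xiid 0 (mesh t k) [set v : seq I | exists2 j, j \in v & J j].
    congr measurable; apply/seteqP; split=> w /=.
      by move=> [j /mapP[s sk ->] Js]; exists s.
    by move=> [s sk Js]; exists (X 0 w s) => //; exact: map_f.
  - rewrite mesh1 => w /=; apply: contra_notP => nh j /mapP[s sk ->] Js.
    by apply: nh; exists s.
rewrite -EFinM; move: h; case: (occ_prob q rho t J) => [r h||h]; rewrite ?leey//; last exact: (h 0%N).
rewrite lee_fin.
have hc : expR (- (lam * t)) * (1 - fine (P (mesh_avoid 1 J t k))) @[k --> \oo] -->
    expR (- (lam * t)) * (1 - survival J t).
  by apply: cvgM; [exact: cvg_cst|apply: cvgB; [exact: cvg_cst|exact: cvg_survival]].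
by apply: (cvgr_to_le hc); apply: nearW => k; rewrite -lee_fin.
Qed.

Lemma survival_le_occ J s t : 0 <= s < t -> (occ_prob q rho s J <= (1 - survival J t)%:E)%E.
Proof.
move=> /andP[s0 st]; rewrite -(occ_probP q rho P X Xiid)//.
rewrite EFinB -survivalE -probability_setC; last exact: measurable_avoid.
apply: le_measure; rewrite ?inE; last 2 first.
- by apply: measurableC; exact: measurable_avoid.
- by move=> w /= Jw /(_ 0%N isT s); apply=> //; rewrite s0.
have := measurable_obs q rho P X Xiid 0 [:: s] [set v | exists j, v = [:: j] /\ J j].
by congr measurable; apply/seteqP; split=> [w [j [[<-]]]|w Jw]//=; exists (X 0 w s).
Qed.

Local Notation dm J := (dmin q (supp rho) J).
Local Notation L J := (Lambda q rho J).

Lemma survival_unreachable J t : 0 <= t ->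
  ~ (exists k, reachable_in q k (supp rho) J) -> survival J t = 1.
Proof.
move=> t0 nr; apply/eqP; rewrite eq_le survival_le1 /=.
have := survival_ge J t t0; rewrite (occ_prob_unreachable q rho)// -EFinM lee_fin.
by rewrite pmulr_rle0 ?expR_gt0// subr_le0.
Qed.

Lemma survival_upper J t : 0 < t ->
  survival J t <= 1 - expR (- (lam * t)) * (L J * t ^+ dm J / (dm J)`!%:R).
Proof.
move=> t0; rewrite lerBrDr -lerBrDl.
have hs s : 0 <= s < t -> expR (- (lam * s)) * (L J * s ^+ dm J / (dm J)`!%:R) <= 1 - survival J t.
  move=> /[dup] st /andP[s0 _]; rewrite -lee_fin; apply: le_trans (survival_le_occ J s t st).
  exact: occ_prob_ge.
(* Since [avoid] stops short of [t], the occupation bound is available only at times [s < t]; it is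
   used along [t - t / n.+1] and extended to [t] by continuity. *)
have ct : t - t * n.+1%:R^-1 @[n --> \oo] --> t.
  rewrite -[X in _ --> X]subr0 -[X in _ - X](mulr0 t).
  by apply: cvgB; [exact: cvg_cst|apply: cvgM; [exact: cvg_cst|exact: cvg_harmonic]].
have hc : expR (- (lam * (t - t * n.+1%:R^-1))) *
    (L J * (t - t * n.+1%:R^-1) ^+ dm J / (dm J)`!%:R) @[n --> \oo] -->
    expR (- (lam * t)) * (L J * t ^+ dm J / (dm J)`!%:R).
  apply: cvgM.
    by apply: cvgr_comp_expR; apply: cvgN; apply: cvgM => //; exact: cvg_cst.
  apply: cvgM; last exact: cvg_cst.
  by apply: cvgM; [exact: cvg_cst|exact: cvgr_exprn].
apply: (cvgr_to_le hc); apply: nearW => n /=; apply: hs; rewrite subr_ge0 ltrBlDr ltrDl mulr_gt0 ?invr_gt0// andbT.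
by rewrite ler_pdivrMr// ler_peMr ?(ltW t0)// ler1n.
Qed.

Lemma survival_lower J t : 0 <= t ->
  1 - expR (lam * t) * (L J * t ^+ dm J / (dm J)`!%:R + (lam * t) ^+ (dm J).+1) <= survival J t.
Proof.
move=> t0; rewrite lerBlDr -lerBlDl.
have := le_trans (survival_ge J t t0) (occ_prob_le q rho qgen qbnd rhoP t J t0).
rewrite -EFinM lee_fin expRN mulrC ler_pdivrMr ?expR_gt0//.
by rewrite [X in _ <= X -> _]mulrC.
Qed.

(** If no target is avoided up to [t], each has a visit time below [t]; as there are finitely many
    targets, the largest of these times is still below [t] and bounds the cover time. *)
Lemma cover_time_geP (UT : {fset I}) N w t : 0 < t ->
  (t%:E <= cover_time X UT N w)%E <-> exists2 j, j \in UT & avoid N [set j] t w.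
Proof.
move=> t0; split=> [tc|[j jU aj]]; last first.
  apply: le_ereal_inf_tmp => _ [u [u0 vu] <-]; rewrite lee_fin leNgt; apply/negP => ut.
  have [n [s [nN [/andP[s0 su] e]]]] := vu j jU.
  by apply: (aj n nN s) e; rewrite s0 (le_lt_trans su).
apply: contrapT => na; move: tc; apply/negP; rewrite -ltNge.
have hv j : j \in UT -> exists s, 0 <= s < t /\ exists2 n, (n < N)%N & X n w s = j.
  move=> jU; apply: contrapT => ns; apply: na; exists j => // n nN s st Xs.
  by apply: ns; exists s; split=> //; exists n.
have [f hf] : exists f : I -> R, forall j, j \in UT ->
    0 <= f j < t /\ exists2 n, (n < N)%N & X n w (f j) = j.
  have /choice[f hf] : forall j, exists s, j \in UT ->
      0 <= s < t /\ exists2 n, (n < N)%N & X n w s = j.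
    by move=> j; have [/hv[s ?]|] := boolP (j \in UT); [exists s|exists 0].
  by exists f.
(* The base value [t / 2] makes [u] positive, as [cover_time] requires, even if all visits occur at
   time 0. *)
pose u := \big[Order.max/(t / 2)]_(j : UT) f (val j).
have ut : u < t.
  apply/bigmax_ltP; split; first by rewrite ltr_pdivrMr// ltr_pMr// ltr1n.
  by move=> j _; have [/andP[]] := hf _ (valP j).
have u0 : 0 < u.
  apply: lt_le_trans (bigmax_ge_id _ _ _ _); by rewrite divr_gt0.
apply: (@le_lt_trans _ _ u%:E); last by rewrite lte_fin.
apply: ereal_inf_lbound; exists u => //; split=> // j /= jU.
have [/andP[f0 _] [n nN e]] := hf j jU.
exists n, (f j); split=> //; split=> //; rewrite f0 /=.
exact: (le_bigmax (t / 2) (fun j : UT => f (val j)) [` jU]%fset).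
Qed.

(** [hit_time] sees positive times only, whereas [avoid] includes time 0; right-constancy moves any
    visit to a positive rational time below [t]. *)
Lemma first_hit_geP N j w t : 0 < t ->
  (t%:E <= first_hit X N j w)%E <-> avoid N [set j] t w.
Proof.
move=> t0; split.
  move=> /bigmin_geP[_ h] n nN s st /= Xs.
  have [r [/andP[r0 rt] Xr]] := path_rat n w t [set j] s st Xs.
  have := h (Ordinal nN) isT; apply/negP; rewrite -ltNge.
  apply: (@le_lt_trans _ _ (ratr r)%:E); last by rewrite lte_fin.
  by apply: ereal_inf_lbound; exists (ratr r).
move=> h; apply/bigmin_geP; split=> [|n _]; first exact: leey.
apply: le_ereal_inf_tmp => _ [u [u0 Xu] <-]; rewrite lee_fin leNgt; apply/negP => ut.
by apply: (h n (ltn_ord n) u) Xu; rewrite ut ltW.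
Qed.

Lemma cover_time_ge0 (UT : {fset I}) N w : (0 <= cover_time X UT N w)%E.
Proof. by apply: le_ereal_inf_tmp => _ [u [u0 _] <-]; rewrite lee_fin ltW. Qed.

Lemma first_hit_ge0 N j w : (0 <= first_hit X N j w)%E.
Proof.
apply/bigmin_geP; split=> [|n _]; first exact: leey.
by apply: le_ereal_inf_tmp => _ [u [u0 _] <-]; rewrite lee_fin ltW.
Qed.

Lemma measurable_fun_ge0_geP (f : Omega -> \bar R) : (forall w, 0 <= f w)%E ->
  (forall t, 0 < t -> measurable [set w | (t%:E <= f w)%E]) -> measurable_fun setT f.
Proof.
move=> f0 mf mD; apply: (measurability _ (ErealGenCInfty.measurableE R)) => //.
move=> _ [_ [t ->] <-]; rewrite setTI.
have [t0|t0] := ltP 0 t.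
  have := mf t t0; congr measurable; apply/seteqP; split=> w /=; rewrite in_itv /= andbT//.
rewrite (_ : _ @^-1` _ = setT)//; apply/seteqP; split=> w //= _.
by rewrite in_itv /= andbT (le_trans _ (f0 w))// lee_fin.
Qed.

Lemma measurable_cover_time_ge (UT : {fset I}) N t : 0 < t ->
  measurable [set w | (t%:E <= cover_time X UT N w)%E].
Proof.
move=> t0; rewrite (_ : [set _ | _] = \bigcup_(j in [set` UT]) avoid N [set j] t).
  by apply: fin_bigcup_measurable => // j _; exact: measurable_avoid.
by apply/seteqP; split=> w /=; rewrite cover_time_geP.
Qed.

Lemma measurable_cover_time (UT : {fset I}) N : measurable_fun setT (cover_time X UT N).
Proof.
apply: measurable_fun_ge0_geP; first exact: cover_time_ge0.
by move=> t; exact: measurable_cover_time_ge.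
Qed.

Lemma measurable_first_hit N j : measurable_fun setT (first_hit X N j).
Proof.
apply: measurable_fun_ge0_geP; first exact: first_hit_ge0.
move=> t t0; have := measurable_avoid N [set j] t; congr measurable.
by apply/seteqP; split=> w /=; rewrite first_hit_geP.
Qed.

(** Markov's inequality for the first hitting time by [N] searchers, with [C] its mean. *)
Lemma survival_tail N j : (\int[P]_w first_hit X N j w < +oo)%E ->
  exists2 C : R, 0 <= C & forall t, 0 < t -> survival [set j] t ^+ N <= C / t.
Proof.
move=> foo; pose C := fine (\int[P]_w first_hit X N j w).
have i0 : (0 <= \int[P]_w first_hit X N j w)%E.
  by apply: integral_ge0 => w _; exact: first_hit_ge0.
exists C => [|t t0]; first exact: fine_ge0.
rewrite ler_pdivlMr// -lee_fin /C fineK ?ge0_fin_numE//.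
rewrite mulrC EFinM.
have := @le_integral_comp_abse _ _ _ P setT measurableT (first_hit X N j) t id.
move=> /(_ (@measurable_id _ _ _) (fun _ => id) (fun _ _ _ _ => id) (measurable_first_hit N j) t0).
rewrite setTI; under eq_integral do rewrite gee0_abs ?first_hit_ge0//.
rewrite (_ : [set w | _] = avoid N [set j] t) ?avoid_indep ?(ltW t0)//; last first.
  by apply/seteqP; split=> w /=; rewrite gee0_abs ?first_hit_ge0// first_hit_geP.
by rewrite -(avoid_indep N [set j] t (ltW t0)).
Qed.

End survival.

(** * Layer cake and the Gamma integral *)

Section layer_cake.
Context {R : realType}.
Local Notation leb := (@lebesgue_measure R).

Lemma lebesgue_layer (a : \bar R) : (0 <= a)%E ->
  leb [set y : R | 0 < y /\ (y%:E <= a)%E] = a.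
Proof.
case: a => [r| |//] r0.
  rewrite (_ : [set _ | _] = `]0, r]%classic); last first.
    apply/seteqP; split=> y /=; rewrite in_itv /= lee_fin; first by move=> [-> ->].
    by move=> /andP[].
  rewrite lebesgue_measure_itv /= lte_fin; case: ltP => [_|]; first by rewrite -EFinB subr0.
  by move=> r0'; congr (_%:E); apply/eqP; rewrite eq_le r0' -lee_fin r0.
rewrite (_ : [set _ | _] = `]0, +oo[%classic); last first.
  by apply/seteqP; split=> y /=; rewrite in_itv /= andbT ?leey; [move=> []|].
by rewrite lebesgue_measure_itv /= ltry.
Qed.

(* Tonelli for the indicator of the region below the graph of f. *)
Lemma layer_cake (d : measure_display) (T : measurableType d)
    (mu : {sigma_finite_measure set T -> \bar R}) (w : T -> R) (f : T -> \bar R) :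
  measurable_fun setT w -> (forall x, 0 <= w x) ->
  measurable_fun setT f -> (forall x, (0 <= f x)%E) ->
  (\int[mu]_x ((w x)%:E * f x) =
   \int[leb]_(y in `]0%R, +oo[) \int[mu]_x (w x * \1_[set x | (y%:E <= f x)%E] x)%:E)%E.
Proof.
move=> mw w0 mf f0.
pose A := [set z : T * R | 0 < z.2 /\ (z.2%:E <= f z.1)%E].
have mA : measurable A.
  rewrite (_ : A = (setT `&` [set z : T * R | 0 < z.2]) `&` (setT `&` [set z | ((EFin \o snd) z <= (f \o fst) z)%E])).
    apply: measurableI.
      rewrite (_ : [set _ | _] = (snd @^-1` `]0%R, +oo[%classic)); last first.
        by apply/seteqP; split=> z /=; rewrite in_itv /= andbT.
      exact: measurable_snd.
    apply: measurable_lee => //.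
      by apply/measurable_EFinP; exact: measurable_snd.
    by apply: (measurableT_comp mf); exact: measurable_fst.
  by apply/seteqP; split=> z /=; [move=> []|move=> [[_ ?] [_ ?]]].
pose g (z : T * R) := (w z.1 * \1_A z)%:E.
have g0 z : (0 <= g z)%E by rewrite lee_fin mulr_ge0.
have mg : measurable_fun setT g.
  apply/measurable_EFinP; apply: measurable_funM.
    exact: (measurableT_comp mw).
  exact: measurable_indic.
have H := @fubini_tonelli _ _ _ _ _ mu leb g mg g0.
transitivity (\int[mu]_x \int[leb]_y g (x, y))%E.
  apply: eq_integral => x _.
  have mx : measurable (xsection A x) by exact: measurable_xsection.
  transitivity (\int[leb]_y ((w x)%:E * (\1_(xsection A x) y)%:E))%E; last first.
    by apply: eq_integral => y _; rewrite /g EFinM !indicE mem_xsection.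
  rewrite ge0_integralZl//=; last 2 first.
  - by apply/measurable_EFinP; exact: measurable_indic.
  - by rewrite lee_fin.
  rewrite integral_indic// setIT -[in LHS](lebesgue_layer (f x))//; congr (_ * leb _)%E.
  by apply/seteqP; split=> y /=; rewrite xsectionE.
rewrite H [RHS]integral_mkcond; apply: eq_integral => y _.
rewrite patchE; case: ifPn; rewrite ?inE ?notin_setE /= in_itv /= andbT => y0.
  apply: eq_integral => x _; rewrite /g; congr (_ * _)%:E.
  rewrite !indicE; congr (_ %:R); congr nat_of_bool; apply/idP/idP; rewrite !inE /A /=.
    by case.
  by split.
rewrite integral0_eq// => x _; rewrite /g indicE memNset ?mulr0// /A /=.
by case.
Qed.

Lemma integral_expRN (b : R) : (\int[leb]_(u in `[b, +oo[) (expR (- u))%:E = (expR (- b))%:E)%E.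
Proof.
have ce : continuous (fun z : R^o => expR (- z) : R^o).
  move=> z; apply: (@continuous_comp _ _ _ (-%R) expR); first exact: continuousN.
  exact: continuous_expR.
rewrite (@ge0_continuous_FTC2y _ _ (fun x => - (expR (- x))) _ 0)//.
- by rewrite EFinN oppeK add0e.
- apply: continuous_subspaceT => z; exact: ce.
- by rewrite -oppr0; apply: cvgN; exact: cvgr_expR.
- by apply: cvgN; apply/cvg_at_right_filter; exact: ce.
- move=> z _.
  rewrite derive1_comp// derive1N// derive1_id mulN1r derive1_comp// derive1E.
  have /funeqP -> := @derive_expR R.
  by rewrite derive1N// derive1_id mulrN1 opprK.
Qed.

Lemma gamma_layer_cake (a c : R) : 0 < a -> 0 < c ->
  (\int[leb]_(y in `]0%R, +oo[) (expR (- (y / c) `^ a^-1))%:E =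
   c%:E * \int[leb]_(u in `]0%R, +oo[) (u `^ a * expR (- u))%:E)%E.
Proof.
move=> a0 c0.
pose w (u : R) := expR (- u) * \1_(`]0%R, +oo[%classic : set R) u.
have w0 u : 0 <= w u by rewrite mulr_ge0 ?expR_ge0.
have mw : measurable_fun setT w.
  apply: measurable_funM; last exact: measurable_indic.
  by apply: measurableT_comp => //; exact: measurable_funN.
pose f (u : R) := (c * u `^ a)%:E.
have f0 u : (0 <= f u)%E by rewrite lee_fin mulr_ge0 ?powR_ge0// ltW.
have mf : measurable_fun setT f.
  apply/measurable_EFinP; apply: measurable_funM => //; exact: measurable_powR.
have := @layer_cake _ _ leb w f mw w0 mf f0.
rewrite (_ : (\int[leb]_x _ = c%:E * \int[leb]_(u in `]0%R, +oo[) (u `^ a * expR (- u))%:E)%E).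
  move=> ->; apply: eq_integral => y; rewrite inE /= in_itv /= andbT => y0.
  rewrite -integral_expRN integral_mkcond; apply: eq_integral => u _.
  rewrite patchE /w; have yc0 : 0 < y / c by rewrite divr_gt0.
  case: ifPn; rewrite ?inE ?notin_setE /= in_itv /= andbT => hu.
    have u0 : 0 < u by apply: lt_le_trans hu; rewrite powR_gt0.
    rewrite !indicE !mem_set ?mulr1//= ?in_itv /= ?u0//.
    rewrite lee_fin mulrC -ler_pdivrMr// -[leLHS]powRr1 ?(ltW yc0)// -(mulVf (lt0r_neq0 a0)) powRrM.
    by apply: ge0_ler_powR; rewrite ?nnegrE ?powR_ge0// ltW.
  have [u0|u0] := ltP 0 u; last first.
    have -> : \1_(`]0%R, +oo[%classic : set R) u = 0 :> R.
      by rewrite indicE memNset//= in_itv /= andbT; apply/negP; rewrite -leNgt.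
    by rewrite mulr0 mul0r.
  have -> : \1_[set x | (y%:E <= f x)%E] u = 0 :> R; last by rewrite mulr0.
  rewrite indicE memNset//= /f lee_fin; apply/negP; rewrite -ltNge.
  rewrite mulrC -ltr_pdivlMr// -[ltRHS]powRr1 ?(ltW yc0)// -(mulVf (lt0r_neq0 a0)) powRrM.
  apply: gt0_ltr_powR; rewrite ?nnegrE ?powR_ge0 ?(ltW u0)//.
  by rewrite ltNge; apply/negP.
rewrite -ge0_integralZl//; last 3 first.
- apply: measurable_funTS; apply/measurable_EFinP; apply: measurable_funM.
    exact: measurable_powR.
  by apply: measurableT_comp => //; exact: measurable_funN.
- by move=> u _; rewrite lee_fin mulr_ge0 ?powR_ge0 ?expR_ge0.
- by rewrite lee_fin ltW.
rewrite [RHS]integral_mkcond; apply: eq_integral => u _; rewrite patchE /w /f indicE.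
case: ifPn => _; last by rewrite mulr0 mul0e.
by rewrite mulr1 -!EFinM; congr (_%:E); ring.
Qed.

End layer_cake.

(** The preimage of an upper half-line under an antitone function on an interval is again an
    interval. *)
Lemma antitone_measurable {R : realType} (D : set R) (f : R -> R) : is_interval D ->
  (forall x y, D x -> D y -> x <= y -> f y <= f x) -> measurable_fun D f.
Proof.
move=> iD hf mD; apply: (measurability _ (RGenCInfty.measurableE R)) => //.
move=> _ [_ [t ->] <-]; apply: is_interval_measurable => x y [Dx tx] [Dy ty] z xzy.
have Dz := iD x y Dx Dy z xzy; split=> //; move: tx ty; rewrite /= !in_itv /= !andbT => tx ty.
by move: xzy => /andP[_ /(hf z y Dz Dy)]; exact: le_trans.
Qed.

(** * The scaling limit of a survival function *)

Section scaling.
Context {R : realType}.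
Implicit Types (x y t m : R) (n d p : nat).

(** The time [t] at which N^(m/d) t^m equals [y], for N = [n.+1] searchers. *)
Definition scaled_time (m : R) (d n : nat) (y : R) : R :=
  y `^ m^-1 * (n.+1%:R^-1) `^ d%:R^-1.

Lemma scaled_time_gt0 m d n y : 0 < y -> 0 < scaled_time m d n y.
Proof. by move=> y0; rewrite mulr_gt0 ?powR_gt0// invr_gt0. Qed.

Lemma scaled_time_expr m d n y : (0 < d)%N -> 0 <= y ->
  n.+1%:R * scaled_time m d n y ^+ d = y `^ (d%:R / m).
Proof.
move=> d0 y0; rewrite /scaled_time exprMn -!powR_mulrn ?powR_ge0// -!powRrM.
rewrite mulVf ?pnatr_eq0 ?lt0n_neq0// powRr1// mulrCA divff ?pnatr_eq0// mulr1.
by rewrite mulrC.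
Qed.

Lemma scaled_time_powR m d n y : 0 < m -> 0 <= y ->
  scaled_time m d n y `^ m = y * (n.+1%:R^-1) `^ (m / d%:R).
Proof.
move=> m0 y0; rewrite /scaled_time powRM ?powR_ge0// -!powRrM mulVf ?lt0r_neq0// powRr1//.
by rewrite [d%:R^-1 * _]mulrC.
Qed.

Lemma cvg_scaled_time m d y : (0 < d)%N -> scaled_time m d n y @[n --> \oo] --> (0 : R).
Proof.
move=> d0; rewrite -[X in _ --> X](mulr0 (y `^ m^-1)); apply: cvgM; first exact: cvg_cst.
have h : (harmonic n : R) @[n --> \oo] --> 0^'+.
  move=> A; rewrite /at_right /within /= => hA.
  have hn : \forall n \near \oo, 0 < (harmonic n : R) -> A (harmonic n).
    exact: (@cvg_harmonic R _ hA).
  by apply: filterS hn => n; apply; rewrite invr_gt0.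
by apply: (cvg_comp _ _ h (powR_cvg0 _)); rewrite invr_gt0 ltr0n.
Qed.

Lemma exp_ge_expr x p : 0 <= x -> x ^+ p <= p`!%:R * expR x.
Proof.
case: p => [|p] x0; first by rewrite expr0 fact0 mul1r (le_trans _ (expR_ge1Dx x))// lerDl.
have := expR_ge1Dxn p x0; move=> h.
rewrite mulrC -ler_pdivrMr ?ltr0n ?fact_gt0//.
by apply: le_trans h; rewrite lerDr.
Qed.

(** Inverting [1 + z <= expR z] at [z = x / (1 - x)]. It yields the exponential lower bound in the
    squeeze for far sets. *)
Lemma oneB_ge_exp x : x < 1 -> expR (- (x / (1 - x))) <= 1 - x.
Proof.
move=> x1; have x1' : 0 < 1 - x by rewrite subr_gt0.
rewrite expRN -[leRHS]invrK lef_pV2 ?posrE ?expR_gt0 ?invr_gt0//.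
rewrite [leLHS](_ : _ = 1 + x / (1 - x)); last by field; rewrite lt0r_neq0.
exact: expR_ge1Dx.
Qed.

Lemma nat_upper_bound x : exists2 p, (0 < p)%N & x <= p%:R.
Proof.
by exists (Num.bound `|x|).+1 => //; rewrite (le_trans (ler_norm x))// (le_trans (ltW (archi_boundP _)))// ler_nat.
Qed.

(** The inverse of [oneDsqr] is the common integrable majorant: this lemma reduces [y >= 1] to a
    decay in y^(-2), and the next one handles bounded values on [0, 1]. *)
Lemma invr_sqr_le y : 1 <= y -> (y ^+ 2)^-1 <= 2 * (oneDsqr y)^-1.
Proof.
move=> y1; have y2 : 1 <= y ^+ 2 by rewrite exprn_ege1.
have y20 : 0 < y ^+ 2 by rewrite (lt_le_trans _ y2).
rewrite ler_pdivlMr ?oneDsqr_gt0// mulrC ler_pdivrMr// /oneDsqr; lra.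
Qed.

Lemma one_le_oneDsqrV y : 0 <= y <= 1 -> 1 <= 2 * (oneDsqr y)^-1.
Proof.
move=> /andP[y0 y1]; rewrite ler_pdivlMr ?oneDsqr_gt0// mul1r /oneDsqr.
have : y ^+ 2 <= 1 by rewrite exprn_ile1.
lra.
Qed.

(** * Pointwise limits and an integrable majorant for powers of a survival function *)

Section profile.
(* S stands for the survival function of a set at distance r from the starting states. *)
Variables (S : R -> R) (lam L : R) (r : nat).
Hypothesis lam_ge0 : 0 <= lam.
Hypothesis L_gt0 : 0 < L.
Hypothesis S_ge0 : forall t, 0 <= S t.
Hypothesis S_le1 : forall t, S t <= 1.
Hypothesis S_upper : forall t, 0 < t -> S t <= 1 - expR (- (lam * t)) * (L * t ^+ r / r`!%:R).

Let a (t : R) := expR (- (lam * t)) * (L * t ^+ r / r`!%:R).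

Let S_exp t n : 0 < t -> S t ^+ n <= expR (- (n%:R * a t)).
Proof.
move=> t0; rewrite -mulrN expRM_natl; apply: lerXn2r; rewrite ?nnegrE ?expR_ge0//.
by apply: le_trans (S_upper t t0) _; exact: expR_ge1Dx.
Qed.

Let rfact_gt0 : 0 < (r`!%:R : R). Proof. by rewrite ltr0n fact_gt0. Qed.

Let cvg_exp_lam m d y : (0 < d)%N -> expR (- (lam * scaled_time m d n y)) @[n --> \oo] --> (1 : R).
Proof.
move=> d0; rewrite -[X in _ --> X]expR0 -[X in expR X]oppr0 -[X in - X](mulr0 lam).
apply: cvgr_comp_expR; apply: cvgN; apply: cvgM; first exact: cvg_cst.
exact: cvg_scaled_time.
Qed.

(** With N = [n.+1], the power is at most exp(-N a(t)), hence at most 1 / (N a(t)). As N t^d stays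
    equal to y^(d/m), this is of order t^(d-r), which vanishes for [r < d]. *)
Lemma cvg_profile_near m d y : (r < d)%N -> 0 < y ->
  S (scaled_time m d n y) ^+ n.+1 @[n --> \oo] --> (0 : R).
Proof.
move=> rd y0; have d0 : (0 < d)%N by exact: leq_ltn_trans rd.
pose x := y `^ (d%:R / m); have x0 : 0 < x by rewrite powR_gt0.
pose t n := scaled_time m d n y.
have t0 n : 0 < t n by exact: scaled_time_gt0.
apply: (@squeeze_cvgr _ _ _ _ (fun=> 0)
   (fun n => t n ^+ (d - r) * (r`!%:R * expR (lam * t n) / (L * x)))); last 2 first.
- exact: cvg_cst.
- rewrite -[X in _ --> X](mul0r (r`!%:R * 1 / (L * x))); apply: cvgM.
    rewrite -[X in _ --> X](_ : 0 ^+ (d - r) = 0); last by rewrite expr0n subn_eq0 leqNgt rd.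
    apply: cvgr_exprn; exact: cvg_scaled_time.
  apply: cvgM; last exact: cvg_cst.
  apply: cvgM; first exact: cvg_cst.
  rewrite -[X in _ --> X]expR0 -(mulr0 lam); apply: cvgr_comp_expR.
  by apply: cvgM; [exact: cvg_cst|exact: cvg_scaled_time].
apply: nearW => n; rewrite exprn_ge0//=.
apply: le_trans (S_exp _ n.+1 (t0 n)) _.
have e : n.+1%:R * a (t n) * (t n ^+ (d - r) * (r`!%:R * expR (lam * t n) / (L * x))) = 1.
  have := scaled_time_expr m d n y d0 (ltW y0); rewrite -/(t n) -/x => xE.
  have eE : expR (- (lam * t n)) * expR (lam * t n) = 1 by rewrite -expRD addNr expR0.
  transitivity ((n.+1%:R * (t n ^+ r * t n ^+ (d - r))) / x * (expR (- (lam * t n)) * expR (lam * t n))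
     * (r`!%:R / r`!%:R) * (L / L)).
    by rewrite /a invfM; ring.
  by rewrite -exprD subnKC ?(ltnW rd)// xE eE !divff ?mulr1// ?lt0r_neq0// fact_gt0.
have a0 : 0 < n.+1%:R * a (t n).
  by rewrite mulr_gt0// mulr_gt0 ?expR_gt0// divr_gt0// mulr_gt0// exprn_gt0.
rewrite -(mulKf (lt0r_neq0 a0) (t n ^+ _ * _)) e mulr1 expRN lef_pV2 ?posrE ?expR_gt0//.
by apply: le_trans (expR_ge1Dx _); rewrite lerDr.
Qed.

Hypothesis S_antitone : forall s t, s <= t -> S t <= S s.

(** For [t <= 1] the short-time bound gives a stretched exponential in [y]. For [t > 1], [M * p]
    searchers supply the polynomial tail (C/t)^p, and the others supply a factor exponentially small
    in N, which absorbs the powers of N lost in passing from [t] to [y]. *)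
Lemma profile_domination m d M C : 0 < m -> (0 < d)%N -> (r <= d)%N -> 0 <= C ->
  (forall t, 0 < t -> S t ^+ M <= C / t) ->
  exists D n0, 0 <= D /\ forall n y, (n0 <= n)%N -> 0 < y ->
    S (scaled_time m d n y) ^+ n.+1 <= D * (oneDsqr y)^-1.
Proof.
move=> m0 d0 rd C0 S_tail.
(* The choice [2 * m <= p] ensures both t^(2m) <= t^p for [t >= 1] and N^(2m/d) <= N^p, which
   together produce the decay y^(-2). *)
have [p p0 mp] := nat_upper_bound (2 * m).
have d1 : 1 <= d%:R :> R by rewrite ler1n.
pose c := expR (- lam) * (L / r`!%:R).
have c0 : 0 < c by rewrite mulr_gt0 ?expR_gt0// divr_gt0.
pose th := S 1.
have th1 : th < 1.
  apply: le_lt_trans (S_upper 1 ltr01) _; rewrite ltrBlDr ltrDl.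
  by rewrite mulr_gt0 ?expR_gt0// expr1n mulr1 divr_gt0.
have th1' : 0 < 1 - th by rewrite subr_gt0.
(* [D1] is the constant of the regime [t <= 1] and [D2] that of [t > 1]; the summand 1 in the final
   constant covers [y <= 1]. *)
pose D1 := p`!%:R / c ^+ p.
pose D2 := C ^+ p * (expR ((1 - th) * (M * p)%:R) * (p`!%:R / (1 - th) ^+ p)).
have D10 : 0 <= D1 by rewrite divr_ge0// exprn_ge0// ltW.
have D20 : 0 <= D2.
  by rewrite mulr_ge0 ?exprn_ge0// mulr_ge0 ?expR_ge0// divr_ge0// exprn_ge0// ltW.
exists (2 * (1 + D1 + D2)), (M * p)%N; split.
  by rewrite mulr_ge0// addr_ge0// addr_ge0.
move=> n y nM y0; set t := scaled_time m d n y.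
have t0 : 0 < t by exact: scaled_time_gt0.
have Dle z : 0 <= z -> z <= 1 + D1 + D2 -> 1 <= y -> S t ^+ n.+1 <= z * (y ^+ 2)^-1 ->
    S t ^+ n.+1 <= 2 * (1 + D1 + D2) * (oneDsqr y)^-1.
  move=> z0 zD y1 /le_trans; apply; rewrite [2 * _]mulrC -mulrA.
  apply: ler_pM => //; last exact: invr_sqr_le.
  by rewrite invr_ge0 exprn_ge0// ltW.
have [t1|t1] := leP t 1.
  (* For [t <= 1] one has exp(-lam) <= exp(-lam t) and t^d <= t^r, so the exponent N a(t) is at
     least c N t^d = c y^(d/m). *)
  have hS : S t ^+ n.+1 <= expR (- (c * y `^ (d%:R / m))).
    apply: le_trans (S_exp _ n.+1 t0) _; rewrite ler_expR lerN2 -(scaled_time_expr m d n y d0 (ltW y0)) -/t.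
    rewrite mulrCA; apply: ler_wpM2l => //; rewrite /a /c -!mulrA.
    apply: ler_pM; rewrite ?expR_ge0//.
    - by rewrite mulr_ge0 ?(ltW L_gt0)// mulr_ge0 ?invr_ge0 ?ltW// exprn_gt0.
    - by rewrite ler_expR lerN2 ler_piMr.
    apply: ler_wpM2l; first exact: ltW.
    rewrite mulrC; apply: ler_wpM2r; first by rewrite invr_ge0 ltW.
    by apply: ler_wiXn2l => //; exact: ltW.
  have [y1|y1] := leP y 1.
    apply: (@le_trans _ _ 1); first by rewrite exprn_ile1.
    rewrite [2 * _]mulrC -mulrA -[leLHS]mulr1; apply: ler_pM => //; last by apply: one_le_oneDsqrV; rewrite (ltW y0).
    by rewrite -addrA lerDl addr_ge0.
  apply: (Dle D1) => //; first by rewrite addrAC lerDr addr_ge0.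
    exact: ltW.
  have xp : y ^+ 2 <= (y `^ (d%:R / m)) ^+ p.
    rewrite -!powR_mulrn ?powR_ge0// ?(ltW y0)// -powRrM; apply: ler_powR; first exact: ltW.
    rewrite mulrAC ler_pdivlMr//; apply: le_trans mp _.
    by rewrite ler_peMl.
  apply: le_trans hS _; rewrite expRN ler_pdivlMr ?exprn_gt0//.
  rewrite mulrC ler_pdivrMr ?expR_gt0//; apply: le_trans xp _.
  rewrite /D1 mulrAC ler_pdivlMr ?exprn_gt0// -exprMn [_ * c]mulrC.
  by apply: exp_ge_expr; rewrite mulr_ge0 ?powR_ge0// ltW.
have yE : t `^ m = y * n.+1%:R^-1 `^ (m / d%:R) by exact: scaled_time_powR m0 (ltW y0).
have N0 : 0 < n.+1%:R :> R by [].
pose Nm : R := n.+1%:R `^ (m / d%:R).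
have Nm0 : 0 < Nm by rewrite powR_gt0.
have yt : y = t `^ m * Nm.
  by rewrite yE -mulrA -powRM ?invr_ge0// mulVf ?lt0r_neq0// powR1 mulr1.
have one_powR z : 1 `^ z = 1 :> R by rewrite powR1.
have tm1 : 1 <= t `^ m.
  by rewrite -[leLHS](one_powR m); apply: ge0_ler_powR; rewrite ?nnegrE// ltW.
have Nm1 : 1 <= Nm.
  by rewrite -[leLHS](one_powR (m / d%:R)); apply: ge0_ler_powR; rewrite ?nnegrE ?divr_ge0 ?ler1n// ltW.
apply: (Dle D2) => //; first by rewrite lerDr addr_ge0.
  by rewrite yt -[leLHS]mulr1; exact: ler_pM.
have tp : (t ^+ p)^-1 <= Nm ^+ 2 * (y ^+ 2)^-1.
  rewrite yt [(t `^ m * Nm) ^+ 2]exprMn invfM mulrCA divff ?mulr1 ?expf_neq0 ?lt0r_neq0//.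
  rewrite lef_pV2 ?posrE ?exprn_gt0 ?powR_gt0//.
  rewrite -!powR_mulrn ?powR_ge0// ?(ltW t0)// -powRrM.
  by apply: ler_powR; [exact: ltW|rewrite mulrC].
have Np : Nm ^+ 2 <= n.+1%:R ^+ p.
  rewrite -!powR_mulrn ?powR_ge0// -powRrM; apply: ler_powR; first by rewrite ler1n.
  rewrite mulrAC ler_pdivrMr ?ltr0n//; apply: le_trans (_ : p%:R * 1 <= _); first by rewrite mulr1 mulrC.
  by apply: ler_wpM2l.
have hth : th ^+ (n.+1 - M * p) <= expR (- ((1 - th) * n.+1%:R)) * expR ((1 - th) * (M * p)%:R).
  rewrite -expRD; apply: (@le_trans _ _ (expR (- (1 - th)) ^+ (n.+1 - M * p))).
    apply: lerXn2r; rewrite ?nnegrE ?expR_ge0//.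
      exact: S_ge0.
    by apply: le_trans (expR_ge1Dx _); rewrite opprB addrCA subrr addr0.
  by rewrite -expRM_natl ler_expR natrB ?(leqW nM)//; lra.
have hN : expR (- ((1 - th) * n.+1%:R)) * n.+1%:R ^+ p <= p`!%:R / (1 - th) ^+ p.
  rewrite ler_pdivlMr ?exprn_gt0// -mulrA -exprMn expRN ler_pdivrMl ?expR_gt0//.
  by rewrite [n.+1%:R * _]mulrC [leRHS]mulrC; apply: exp_ge_expr; rewrite mulr_ge0// ltW.
(* [p] groups of [M] searchers are set aside for the tail bound; [M * p <= n] makes the subtraction
   exact. *)
have -> : S t ^+ n.+1 = S t ^+ (n.+1 - M * p) * (S t ^+ M) ^+ p.
  by rewrite -exprM -exprD subnK ?(leqW nM).
apply: (@le_trans _ _ (th ^+ (n.+1 - M * p) * (C / t) ^+ p)).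
  apply: ler_pM; rewrite ?exprn_ge0//.
    by apply: lerXn2r; rewrite ?nnegrE /th ?S_ge0//; apply: S_antitone; exact: ltW.
  by apply: lerXn2r; rewrite ?nnegrE ?exprn_ge0 ?divr_ge0 ?(ltW t0) ?S_ge0 ?S_tail.
apply: (@le_trans _ _ (expR (- ((1 - th) * n.+1%:R)) * expR ((1 - th) * (M * p)%:R) *
   (C ^+ p * (n.+1%:R ^+ p * (y ^+ 2)^-1)))).
  apply: ler_pM => //; rewrite ?exprn_ge0 ?divr_ge0 ?(ltW t0) ?S_ge0//.
  rewrite exprMn exprVn; apply: ler_wpM2l; first by rewrite exprn_ge0.
  apply: le_trans tp _; apply: ler_wpM2r => //.
  by rewrite invr_ge0 exprn_ge0// ltW.
rewrite /D2.
have -> : forall A B C' N' Y : R, A * B * (C' * (N' * Y)) = C' * (B * (A * N')) * Y by move=> *; ring.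
apply: ler_wpM2r; first by rewrite invr_ge0 exprn_ge0// ltW.
apply: ler_wpM2l; first by rewrite exprn_ge0.
by apply: ler_wpM2l; rewrite ?expR_ge0.
Qed.


Hypothesis S_lower : forall t, 0 < t ->
  1 - expR (lam * t) * (L * t ^+ r / r`!%:R + (lam * t) ^+ r.+1) <= S t.

(** Squeeze between exp(-N b / (1 - b)) and exp(-N a), where [a] and [b] bound the hitting
    probability from below and above: [b] tends to 0, while N a and N b both tend to (L / r!)
    y^(r/m). *)
Lemma cvg_profile_far m y : (0 < r)%N -> 0 < y ->
  S (scaled_time m r n y) ^+ n.+1 @[n --> \oo] --> expR (- (L / r`!%:R * y `^ (r%:R / m))).
Proof.
move=> r0 y0; pose x := y `^ (r%:R / m); have x0 : 0 < x by rewrite powR_gt0.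
pose t n := scaled_time m r n y.
have t0 n : 0 < t n by exact: scaled_time_gt0.
have xE n : n.+1%:R * t n ^+ r = x by exact: scaled_time_expr (ltW y0).
have tc : t n @[n --> \oo] --> (0 : R) by exact: cvg_scaled_time.
have ec : expR (lam * t n) @[n --> \oo] --> (1 : R).
  rewrite -[X in _ --> X]expR0 -(mulr0 lam); apply: cvgr_comp_expR.
  by apply: cvgM => //; exact: cvg_cst.
pose b n := expR (lam * t n) * (L * t n ^+ r / r`!%:R + (lam * t n) ^+ r.+1).
have bc : b n @[n --> \oo] --> (0 : R).
  rewrite -[X in _ --> X](_ : 1 * (L * 0 ^+ r / r`!%:R + (lam * 0) ^+ r.+1) = 0); last first.
    by rewrite mulr0 !expr0n (gtn_eqF r0) /= mulr0 mul0r add0r mulr0.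
  apply: cvgM => //; apply: cvgD.
    apply: cvgM; last exact: cvg_cst.
    by apply: cvgM; [exact: cvg_cst|exact: cvgr_exprn].
  by apply: cvgr_exprn; apply: cvgM => //; exact: cvg_cst.
have bNE n : n.+1%:R * b n = expR (lam * t n) * (L / r`!%:R * x + lam ^+ r.+1 * (x * t n)).
  by rewrite -(xE n) /b [(lam * t n) ^+ _]exprMn [t n ^+ r.+1]exprSr; ring.
have bNc : n.+1%:R * b n @[n --> \oo] --> L / r`!%:R * x.
  rewrite (_ : (fun n => _) = fun n => expR (lam * t n) *
    (L / r`!%:R * x + lam ^+ r.+1 * (x * t n))); last by apply/funext => n; rewrite bNE.
  rewrite -[X in _ --> X](_ : 1 * (L / r`!%:R * x + lam ^+ r.+1 * (x * 0)) = _); last first.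
    by rewrite mulr0 mulr0 addr0 mul1r.
  apply: cvgM => //; apply: cvgD; first exact: cvg_cst.
  by apply: cvgM; [exact: cvg_cst|apply: cvgM => //; exact: cvg_cst].
apply: (@squeeze_cvgr _ _ _ _ (fun n => expR (- (n.+1%:R * b n / (1 - b n))))
   (fun n => expR (- (n.+1%:R * a (t n))))); last 2 first.
- apply: cvgr_comp_expR; apply: cvgN.
  rewrite -[X in _ --> X](_ : L / r`!%:R * x / (1 - 0) = _); last by rewrite subr0 divr1.
  apply: cvgM => //; apply: cvgV; first by rewrite subr0 oner_neq0.
  by apply: cvgB => //; exact: cvg_cst.
- apply: cvgr_comp_expR; apply: cvgN.
  have aE n : n.+1%:R * a (t n) = expR (- (lam * t n)) * (L / r`!%:R * x).
    by rewrite -(xE n) /a; ring.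
  rewrite (_ : (fun n => _) = fun n => expR (- (lam * t n)) * (L / r`!%:R * x)); last first.
    by apply/funext => n; rewrite aE.
  rewrite -[X in _ --> X](mul1r (L / r`!%:R * x)); apply: cvgM; last exact: cvg_cst.
  exact: cvg_exp_lam.
near=> n.
apply/andP; split; last exact: (S_exp (t n) n.+1 (t0 n)).
(* The lower exponential bound needs [b n < 1], which holds only for large [n]. *)
have b1 : b n < 1 by near: n; exact: (cvgr_lt 0).
rewrite -mulrA -mulrN expRM_natl; apply: lerXn2r; rewrite ?nnegrE ?expR_ge0//.
by apply: le_trans (oneB_ge_exp (b n) b1) _; exact: S_lower.
Unshelve. all: by end_near.
Qed.

End profile.
End scaling.

(** * Moments of first hitting times of subsets *)

Section cover_time_moments.
Context {R : realType} {I : countType} {d : measure_display} {Omega : measurableType d}.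
Variables (q : I -> I -> R) (rho : I -> R) (P : probability Omega R).
Variables (X : nat -> Omega -> R -> I) (UT : {fset I}) (m : R).
Hypothesis qgen : is_generator q.
Hypothesis qbnd : bounded_rates q.
Hypothesis rhoP : is_distribution rho.
Hypothesis Xiid : iid_CTMC q rho P X.
Hypothesis UT_out : ~ ([set j | j \in UT] `<=` supp rho).
Hypothesis UT_hit : forall j, j \in UT -> exists N : nat, (1 <= N)%N /\
  (\int[P]_w first_hit X N j w < +oo)%E.
Hypothesis m_gt0 : 0 < m.
Local Notation leb := (@lebesgue_measure R).
Local Notation lam := (unif_rate q).
Local Notation dm J := (dmin q (supp rho) J).
Local Notation L J := (Lambda q rho J).
Local Notation D0 := (`]0%R, +oo[%classic : set R).
Let dd := dfar q rho UT.

Let D0P y : D0 y <-> 0 < y.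
Proof. by rewrite /= in_itv /= andbT. Qed.

(** An unreachable target would have survival probability 1 forever, contradicting the tail bound
    C/t at [t = C + 1]. *)
Lemma target_reachable j : j \in UT -> exists k, reachable_in q k (supp rho) [set j].
Proof.
move=> jU; apply: contrapT => nr.
have [N [N1 /(survival_tail q rho P X Xiid)[C C0 hC]]] := UT_hit j jU.
have C1 : 0 < C + 1 by rewrite addrC ltr_pwDl.
have := hC (C + 1) C1; rewrite (survival_unreachable q rho P X qgen qbnd rhoP Xiid)//; last exact: ltW.
by rewrite expr1n ler_pdivlMr// mul1r gerDl ler10.
Qed.

Lemma dmin_le_dfar j : j \in UT -> (dm [set j] <= dd)%N.
Proof. by move=> jU; rewrite /dd /dfar (bigD1_seq j)//= leq_maxl. Qed.

(** A target outside the support cannot be at distance 0: being reachable, it has a [dmin] attained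
    by an actual path rather than given by the default value 0. *)
Lemma dfar_gt0 : (0 < dd)%N.
Proof.
have [j [jU js]] : exists j, j \in UT /\ ~ supp rho j.
  by apply: contrapT => h; apply: UT_out => j /= jU; apply: contrapT => js; apply: h; exists j.
apply: leq_trans (dmin_le_dfar j jU); rewrite lt0n; apply/eqP => d0.
have [x [s [sd [_ [xs]]]]] := dmin_reachable q _ _ (target_reachable j jU).
by move: sd; rewrite d0 => /size0nil -> /= xj; apply: js; rewrite -xj.
Qed.

Lemma reachable_sub (A B C : set I) k : B `<=` C ->
  reachable_in q k A B -> reachable_in q k A C.
Proof. by move=> BC [x [s [sk [p [Ax Bl]]]]]; exists x, s; do ?split=> //; exact: BC. Qed.

Lemma reachable_sup (A C : set I) k : reachable_in q k A C ->
  exists2 j, C j & reachable_in q k A [set j].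
Proof. by move=> [x [s [sk [p [Ax Bl]]]]]; exists (last x s) => //; exists x, s. Qed.

(** A shortest path into [J] ends at one of its points, so the distance to [J] is the least distance
    to a point of [J]. *)
Lemma dmin_far (J : set I) : J !=set0 ->
  (forall j, J j -> j \in UT /\ dm [set j] = dd) -> dm J = dd.
Proof.
move=> [j Jj] hJ; have [jU jd] := hJ j Jj.
have rJ : reachable_in q dd (supp rho) J.
  apply: (@reachable_sub _ [set j]); first by move=> _ ->.
  by rewrite -jd; apply: dmin_reachable; exact: target_reachable.
apply/eqP; rewrite eqn_leq dmin_min//=.
have /reachable_sup[i Ji /dmin_min] : reachable_in q (dm J) (supp rho) J.
  by apply: dmin_reachable; exists dd.
by have [_ ->] := hJ i Ji.
Qed.

Definition scaled_survival (J : set I) (n : nat) (y : R) : R :=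
  survival P X J (scaled_time m dd n y) ^+ n.+1.

Lemma scaled_survival_ge0 J n y : 0 <= scaled_survival J n y.
Proof. by rewrite exprn_ge0// survival_ge0. Qed.

Let bound_at (j : I) (C : R) (n0 : nat) := forall n y, (n0 <= n)%N -> 0 < y ->
  scaled_survival [set j] n y <= C * (oneDsqr y)^-1.

Let bound_target j : j \in UT -> exists C n0, 0 <= C /\ bound_at j C n0.
Proof.
move=> jU; have [M [M1 /(survival_tail q rho P X Xiid)[C C0 hC]]] := UT_hit j jU.
apply: (profile_domination (survival P X [set j]) lam (L [set j]) (dm [set j]) _ _ _ _ _ _ m dd M C) => //.
- exact: ltW (unif_rate_gt0 q rho qbnd rhoP).
- by apply: Lambda_gt0 => //; exact: target_reachable.
- by move=> t; exact: survival_ge0.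
- by move=> t; exact: (survival_le1 q rho P X Xiid).
- by move=> t; exact: (survival_upper q rho P X qgen qbnd rhoP Xiid).
- by move=> s t; exact: (survival_le q rho P X Xiid).
- exact: dfar_gt0.
- exact: dmin_le_dfar.
Qed.

Lemma scaled_survival_bounded : exists C n0, 0 <= C /\
  forall j, j \in UT -> forall n y, (n0 <= n)%N -> 0 < y ->
    scaled_survival [set j] n y <= C * (oneDsqr y)^-1.
Proof.
have : forall s : seq I, {subset s <= UT} -> exists C n0, 0 <= C /\ forall j, j \in s -> bound_at j C n0.
  elim=> [_|j s IH sU]; first by exists 0, 0%N.
  have [i si|C [n0 [C0 h]]] := IH; first by apply: sU; rewrite inE si orbT.
  have [|C' [n0' [C0' h']]] := bound_target j; first by apply: sU; rewrite inE eqxx.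
  exists (C + C'), (maxn n0 n0'); split; first exact: addr_ge0.
  move=> i; rewrite inE => /predU1P[->|/h hi] n y; rewrite geq_max => /andP[n1 n2] y0.
    apply: le_trans (h' n y n2 y0) _; apply: ler_wpM2r; last by rewrite lerDr.
    by rewrite invr_ge0 ltW// oneDsqr_gt0.
  apply: le_trans (hi n y n1 y0) _; apply: ler_wpM2r; last by rewrite lerDl.
  by rewrite invr_ge0 ltW// oneDsqr_gt0.
by move=> /(_ UT)[//|C [n0 [C0 h]]]; exists C, n0.
Qed.

Lemma scaled_survival_antitone (A B : set I) n y : A `<=` B ->
  scaled_survival B n y <= scaled_survival A n y.
Proof.
move=> AB; apply: lerXn2r; rewrite ?nnegrE ?survival_ge0//.
exact: (survival_antitone q rho P X Xiid).
Qed.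

Lemma measurable_scaled_survival J n : measurable_fun D0 (scaled_survival J n).
Proof.
apply: antitone_measurable; first exact: interval_is_interval.
move=> x y /D0P x0 /D0P y0 xy; apply: lerXn2r; rewrite ?nnegrE ?survival_ge0//.
apply: (survival_le q rho P X Xiid); apply: ler_wpM2r; first exact: powR_ge0.
by apply: ge0_ler_powR; rewrite ?nnegrE ?invr_ge0 ?(ltW m_gt0) ?(ltW x0) ?(ltW y0).
Qed.

Lemma integrable_oneDsqrV (C : R) : leb.-integrable D0 (fun y => (C * (oneDsqr y)^-1)%:E).
Proof.
have mo : measurable_fun D0 (fun y : R => (oneDsqr y)^-1).
  by apply: measurable_funTS; apply: continuous_measurable_fun; exact: continuous_oneDsqrV.
rewrite (_ : (fun y => _) = fun y => (C%:E * (oneDsqr y)^-1%:E)%E)//.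
apply: integrableZl => //; apply/integrableP; split; first exact/measurable_EFinP.
rewrite [X in (X < _)%E](_ : _ = \int[leb]_(y in D0) (oneDsqr y)^-1%:E)%E; last first.
  by apply: eq_integral => y _; rewrite gee0_abs// lee_fin invr_ge0 ltW// oneDsqr_gt0.
by rewrite integral_itv_obnd_cbnd ?integral0y_oneDsqr ?ltry//; exact/measurable_EFinP.
Qed.

(** By the layer cake formula this is N^(m/d) times the [m]-th moment of the first time at which one
    of N = [n.+1] searchers is in [J]. *)
Definition moment (J : set I) (n : nat) : \bar R :=
  (\int[leb]_(y in D0) (scaled_survival J n y)%:E)%E.

(** * Passage to the limit under the integral *)

Section dominated.
Variables (C : R) (n0 : nat).
Hypothesis C_ge0 : 0 <= C.
Hypothesis dom : forall j, j \in UT -> forall n y, (n0 <= n)%N -> 0 < y ->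
    scaled_survival [set j] n y <= C * (oneDsqr y)^-1.

Lemma integrable_scaled_survival (J : set I) j n : J j -> j \in UT -> (n0 <= n)%N ->
  leb.-integrable D0 (EFin \o scaled_survival J n).
Proof.
move=> Jj jU n0n; apply: le_integrable (integrable_oneDsqrV C) => //.
  by apply/measurable_EFinP; exact: measurable_scaled_survival.
move=> y /D0P y0; rewrite /= lee_fin !ger0_norm ?scaled_survival_ge0//; last first.
  by apply: mulr_ge0 => //; rewrite invr_ge0 ltW// oneDsqr_gt0.
apply: le_trans (dom j jU n y n0n y0); apply: scaled_survival_antitone.
by move=> _ ->.
Qed.

(** Avoiding [J] entails avoiding the target [j], so the majorant for [j] serves for [J]. The index
    is shifted by [n0] so that domination holds for the whole sequence. *)
Lemma cvg_moment (J : set I) j (l : R -> R) : J j -> j \in UT ->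
  measurable_fun D0 l ->
  (forall y, 0 < y -> scaled_survival J n y @[n --> \oo] --> l y) ->
  leb.-integrable D0 (EFin \o l) /\
  moment J (k + n0) @[k --> \oo] --> (\int[leb]_(y in D0) (l y)%:E)%E.
Proof.
move=> Jj jU ml hl.
have [] := @dominated_convergence _ _ R leb D0 (measurable_itv _)
  (fun k y => (scaled_survival J (k + n0) y)%:E) (fun y => (l y)%:E)
  (fun y => (C * (oneDsqr y)^-1)%:E).
- by move=> k; apply/measurable_EFinP; exact: measurable_scaled_survival.
- exact/measurable_EFinP.
- apply: aeW => y /D0P y0; apply: cvg_EFin; first exact: nearW.
  by have := hl y y0; rewrite -(cvg_shiftn n0).
- exact: integrable_oneDsqrV.
- apply: aeW => y k /D0P y0; rewrite gee0_abs ?lee_fin ?scaled_survival_ge0//.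
  apply: le_trans (dom j jU _ y (leq_addl k n0) y0); apply: scaled_survival_antitone.
  by move=> _ ->.
by move=> il _ hc; split.
Qed.

Lemma cvg_moment_near j : j \in UT -> (dm [set j] < dd)%N ->
  moment [set j] (k + n0) @[k --> \oo] --> 0%E.
Proof.
move=> jU jd; have [//||_] := @cvg_moment [set j] j (fun=> 0) erefl jU.
  move=> y y0; apply: (cvg_profile_near (survival P X [set j]) lam (L [set j]) (dm [set j])) => //.
  - by apply: Lambda_gt0 => //; exact: target_reachable.
  - by move=> t; exact: survival_ge0.
  - by move=> t; exact: (survival_upper q rho P X qgen qbnd rhoP Xiid).
by rewrite integral0.
Qed.

Lemma cvg_moment_far (J : set I) : J !=set0 ->
  (forall j, J j -> j \in UT /\ dm [set j] = dd) ->
  moment J (k + n0) @[k --> \oo] -->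
    (((dd`!)%:R / L J) `^ (m / dd%:R) * Gamma (1 + m / dd%:R))%:E.
Proof.
move=> J0 hJ; have [j Jj] := J0; have [jU jd] := hJ j Jj.
have dJ := dmin_far J J0 hJ; have d0 := dfar_gt0.
have LJ : 0 < L J.
  apply: Lambda_gt0 => //; have [k hk] := target_reachable j jU.
  by exists k; apply: reachable_sub hk => _ ->.
pose a := m / dd%:R; have a0 : 0 < a by rewrite divr_gt0// ltr0n.
have fL : 0 < dd`!%:R / L J by rewrite divr_gt0// ltr0n fact_gt0.
(* This [c] brings the limiting survival function into the form integrated by [gamma_layer_cake]. *)
pose c := (dd`!%:R / L J) `^ a; have c0 : 0 < c by rewrite powR_gt0.
have lE y : 0 < y -> expR (- (L J / dd`!%:R * y `^ (dd%:R / m))) = expR (- (y / c) `^ a^-1).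
  move=> y0; have cV0 : 0 <= c^-1 by rewrite invr_ge0 ltW.
  rewrite (powRM _ (ltW y0) cV0).
  have -> : c^-1 `^ a^-1 = L J / dd`!%:R.
    rewrite -(powR_inv1 (ltW c0)) /c -!powRrM ?mulrA mulrN1 mulNr divff ?lt0r_neq0//.
    by rewrite (powR_inv1 (ltW fL)) invf_div.
  by rewrite /a invf_div mulrC.
have [|y y0|il] := @cvg_moment J j (fun y => expR (- (y / c) `^ a^-1)) Jj jU.
- apply: measurable_funTS; apply: measurableT_comp => //; apply: measurable_funN.
  apply: (measurableT_comp (measurable_powR a^-1)).
  exact: measurable_funM.
- rewrite -lE// /scaled_survival -dJ.
  apply: (cvg_profile_far (survival P X J) lam (L J) (dm J)) => //.
  - by move=> t; exact: survival_ge0.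
  - by move=> t; exact: (survival_upper q rho P X qgen qbnd rhoP Xiid).
  - by move=> t t0; apply: (survival_lower q rho P X qgen qbnd rhoP Xiid); exact: ltW.
  - by rewrite dJ.
rewrite gamma_layer_cake//; congr (_ --> _).
have GE : (\int[leb]_(u in D0) (u `^ a * expR (- u))%:E = (Gamma (1 + a))%:E)%E.
  rewrite /Gamma; under [in RHS]eq_integral do rewrite addrC addKr.
  (* Finiteness of the Gamma integral is read off from the integrability of the limit, of which it
     is a multiple by 1/c. *)
  rewrite fineK//; have /(_ (measurable_itv _)) := fun h => integrable_fin_num h il.
  rewrite gamma_layer_cake// ; have : (0 <= \int[leb]_(u in D0) (u `^ a * expR (- u))%:E)%E.
    by apply: integral_ge0 => u _; rewrite lee_fin mulr_ge0 ?powR_ge0 ?expR_ge0.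
  by case: (integral _ _ _) => //= _; rewrite gt0_muley.
by rewrite GE -EFinM.
Qed.

End dominated.
End cover_time_moments.

(** * Inclusion-exclusion and the cover time *)

(** The indicator of the complement of the union is the product of the factors 1 - 1_{A j};
    expanding it over subsets and integrating gives the formula. *)
Lemma inclusion_exclusion {R : realType} {d : measure_display} {Omega : measurableType d}
    (P : probability Omega R) (T : finType) (A : T -> set Omega) :
  (forall j, measurable (A j)) ->
  (P (\bigcup_j A j) = (\sum_(J : {set T} | (0 < #|J|)%N)
     (-1) ^+ #|J|.-1 * fine (P [set w | forall j, j \in J -> A j w]))%:E)%E.
Proof.
move=> mA.
pose B (J : {set T}) := [set w | forall j, j \in J -> A j w].
have mB J : measurable (B J).
  rewrite (_ : B J = \bigcap_(j in [set j | j \in J]) A j); last by apply/seteqP; split.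
  by apply: fin_bigcap_measurable => //; exact: finite_finset.
have mU : measurable (\bigcup_j A j).
  by apply: fin_bigcup_measurable => //; exact: finite_finset.
have iB (J : {set T}) w : \prod_(j in J) (\1_(A j) w : R) = \1_(B J) w.
  have [Bw|nBw] := pselect (B J w).
    by rewrite indicE mem_set// big1// => j jJ; rewrite indicE mem_set//; exact: Bw.
  rewrite [RHS]indicE memNset//=.
  have [j jJ nAj] : exists2 j, j \in J & ~ A j w.
    by apply: contrapT => h; apply: nBw => j jJ; apply: contrapT => nA; apply: h; exists j.
  by rewrite (bigD1 j jJ)/= indicE memNset// mul0r.
have E w : \1_(\bigcup_j A j) w = \sum_(J : {set T} | (0 < #|J|)%N) (-1) ^+ #|J|.-1 * (\1_(B J) w : R).
  have D : \prod_i (- (\1_(A i) w : R) + 1) =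
      \sum_(J : {set T}) \prod_i (if i \in J then - (\1_(A i) w : R) else 1).
    exact: (bigA_distr 1 +%R (fun j => - (\1_(A j) w : R)) (fun=> 1)).
  have D0 : \prod_i (if i \in @finset.set0 T then - (\1_(A i) w : R) else 1) = 1.
    by rewrite big1 // => i _; rewrite finset.in_set0.
  move: D; rewrite [X in _ = X -> _](bigD1 finset.set0)//= D0.
  have -> : \prod_i (- (\1_(A i) w : R) + 1) = 1 - \1_(\bigcup_j A j) w.
    have [[j _ Aj]|nA] := pselect ((\bigcup_j A j) w).
      rewrite [in RHS]indicE mem_set ?subrr; last by exists j.
      by rewrite (bigD1 j)//= indicE mem_set// addNr mul0r.
    rewrite [in RHS]indicE memNset// subr0 big1// => j _.
    by rewrite indicE memNset ?oppr0 ?add0r// => Aj; apply: nA; exists j.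
  (* The empty subset accounts for the 1 on both sides. Cancelling it and changing sign leaves the
     nonempty subsets with exponent [#|J|.-1]. *)
  move=> /addrI h; rewrite -[LHS]opprK h -sumrN; apply: eq_big => J.
    by rewrite card_gt0.
  rewrite -card_gt0 => J0; rewrite -big_mkcond/= prodrN iB -mulNr; congr (_ * _).
  by rewrite -{1}(prednK J0) exprS mulN1r opprK.
pose h (J : {set T}) w : \bar R := if (0 < #|J|)%N then
   (((-1) ^+ #|J|.-1)%:E * (\1_(B J) w)%:E)%E else 0%E.
transitivity (\int[P]_w (\1_(\bigcup_j A j) w)%:E)%E; first by rewrite integral_indic// setIT.
transitivity (\int[P]_w \sum_(J : {set T}) h J w)%E.
  apply: eq_integral => w _; rewrite E -sumEFin big_mkcond/=; apply: eq_bigr => J _.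
  by rewrite /h; case: ifP.
have iI J : P.-integrable setT (fun w => (\1_(B J) w)%:E) by exact: integrable_indic.
rewrite integral_sum//; last first.
  move=> J; rewrite /h; case: (boolP (0 < #|J|)%N) => J0; last exact: integrable0.
  exact: integrableZl.
rewrite -sumEFin [RHS]big_mkcond/=; apply: eq_bigr => J _; rewrite /h.
case: ifP => J0; last by rewrite integral0.
by rewrite integralZl// integral_indic// setIT EFinM -/(B J) fineK// fin_num_measure//; exact: mB.
Qed.

(** Passes from the summation by size in [Kconst] to the sum over nonempty subsets produced by
    inclusion-exclusion. *)
Lemma sum_by_card {R : realType} (T : finType) (t : {set T} -> R) :
  \sum_(1 <= i < #|T|.+1) ((-1) ^+ i.-1 * \sum_(J : {set T} | #|J| == i) t J) =
  \sum_(J : {set T} | (0 < #|J|)%N) (-1) ^+ #|J|.-1 * t J.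
Proof.
transitivity (\sum_(1 <= i < #|T|.+1) \sum_(J : {set T})
    (if i == #|J| then (-1) ^+ #|J|.-1 * t J else 0)).
  apply: eq_bigr => i _; rewrite big_distrr/= big_mkcond; apply: eq_bigr => J _.
  by rewrite eq_sym; case: eqP => // ->.
rewrite exchange_big/= [RHS]big_mkcond; apply: eq_bigr => J _.
by rewrite -big_mkcond big_nat1_eq ltnS max_card andbT.
Qed.

(** * Bounds on the cover time by unions of avoidance events *)

Section assembly.
Context {R : realType} {I : countType} {d : measure_display} {Omega : measurableType d}.
Variables (q : I -> I -> R) (rho : I -> R) (P : probability Omega R).
Variables (X : nat -> Omega -> R -> I) (UT : {fset I}) (m : R).
Hypothesis qgen : is_generator q.
Hypothesis qbnd : bounded_rates q.
Hypothesis rhoP : is_distribution rho.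
Hypothesis Xiid : iid_CTMC q rho P X.
Hypothesis UT_out : ~ ([set j | j \in UT] `<=` supp rho).
Hypothesis UT_hit : forall j, j \in UT -> exists N : nat, (1 <= N)%N /\
  (\int[P]_w first_hit X N j w < +oo)%E.
Hypothesis m_gt0 : 0 < m.
Local Notation leb := (@lebesgue_measure R).
Local Notation dm J := (dmin q (supp rho) J).
Local Notation D0 := (`]0%R, +oo[%classic : set R).
Local Notation dd := (dfar q rho UT).
Local Notation F := (UTfar q rho UT).
Local Notation time n y := (scaled_time m dd n y).
Local Notation surv J n y := (scaled_survival q rho P X UT m J n y).
Local Notation mom J n := (moment q rho P X UT m J n).

Let D0P y : D0 y <-> 0 < y.
Proof. by rewrite /= in_itv /= andbT. Qed.

Let cover_ge n y := [set w | ((time n y)%:E <= cover_time X UT n.+1 w)%E].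

Lemma moment_cover_time n :
  ((n.+1%:R `^ (m / dd%:R))%:E * \int[P]_w (cover_time X UT n.+1 w `^ m) =
   \int[leb]_(y in D0) P (cover_ge n y))%E.
Proof.
pose Nm : R := n.+1%:R `^ (m / dd%:R).
have Nm0 : 0 < Nm by rewrite powR_gt0.
have ms := measurable_cover_time q rho P X Xiid UT n.+1.
have mp : measurable_fun setT (fun w => (cover_time X UT n.+1 w `^ m)%E).
  exact: (measurableT_comp (measurable_poweR m) ms).
pose f w := (Nm%:E * cover_time X UT n.+1 w `^ m)%E.
have f0 w : (0 <= f w)%E by rewrite mule_ge0 ?poweR_ge0// lee_fin ltW.
have mf : measurable_fun setT f by apply: measurable_funeM.
rewrite -ge0_integralZl//=; last by move=> w _; exact: poweR_ge0.
have := @layer_cake R _ _ P (fun=> 1) f (measurable_cst _) (fun=> ler01) mf f0.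
under eq_integral do rewrite mul1e.
move=> ->; apply: eq_integral => y; rewrite inE => /D0P y0.
under eq_integral do rewrite mul1r.
have -> : [set w | (y%:E <= f w)%E] = cover_ge n y.
  have t0 : 0 < time n y by exact: scaled_time_gt0.
  have yE : y = time n y `^ m * Nm.
    rewrite (scaled_time_powR m dd n y m_gt0 (ltW y0)) -mulrA -powRM ?invr_ge0//.
    by rewrite mulVf ?pnatr_eq0// powR1 mulr1.
  have yE' : y%:E = (Nm%:E * (time n y `^ m)%:E)%E by rewrite -EFinM mulrC -yE.
  have key w : (y%:E <= f w)%E = ((time n y `^ m)%:E <= cover_time X UT n.+1 w `^ m)%E.
    by rewrite yE' /f lee_pmul2l.
  apply/seteqP; split=> w; rewrite /cover_ge /= key;
    case: (cover_time X UT n.+1 w) (cover_time_ge0 X UT n.+1 w) => [s||]//.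
  - rewrite poweR_EFin !lee_fin => s0 h; rewrite leNgt; apply/negP => st.
    by move: h; apply/negP; rewrite -ltNge; apply: gt0_ltr_powR; rewrite ?nnegrE ?(ltW t0).
  - by move=> _ _; rewrite leey.
  - rewrite poweR_EFin !lee_fin => s0 h.
    by apply: ge0_ler_powR; rewrite ?nnegrE ?(ltW t0) ?(ltW m_gt0).
  - by rewrite poweRyr ?leey// lt0r_neq0.
by rewrite integral_indic ?setIT//; apply: (measurable_cover_time_ge q rho P X Xiid); exact: scaled_time_gt0.
Qed.

Let jset (J : {set F}) : set I := [set val x | x in [set x | x \in J]].

Let far_union n y := \bigcup_(j : F) avoid X n.+1 [set val j] (time n y).

Let far_prob n y : R := \sum_(J : {set F} | (0 < #|J|)%N) (-1) ^+ #|J|.-1 * surv (jset J) n y.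

(** Avoiding every single state of [J] is avoiding the set [J], so each intersection is again an
    [avoid] event, with probability a power of the survival function. *)
Let far_unionE n y : 0 < y -> P (far_union n y) = (far_prob n y)%:E.
Proof.
move=> y0; have t0 := scaled_time_gt0 m dd n y y0.
rewrite inclusion_exclusion; last by move=> j; exact: (measurable_avoid q rho P X Xiid).
congr (_%:E); apply: eq_bigr => J J0; congr (_ * _).
rewrite (_ : [set w | _] = avoid X n.+1 (jset J) (time n y)).
  by rewrite (avoid_indep q rho P X Xiid) ?ltW.
apply/seteqP; split=> w h.
  by move=> k kn s st [j /= jJ jX]; apply: (h j jJ k kn s st); rewrite /= jX.
by move=> j jJ k kn s st /= jX; apply: (h k kn s st); exists j.
Qed.

Let farP j : j \in F -> j \in UT /\ dm [set j] = dd.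
Proof. by rewrite !inE => /andP[-> /eqP]. Qed.

(** A target that is not far is strictly nearer, [dfar] being the maximal distance; a union bound
    over these targets gives the error term. *)
Let cover_ge_bounds n y : 0 < y ->
  (P (far_union n y) <= P (cover_ge n y))%E /\
  (P (cover_ge n y) <= P (far_union n y) +
     \sum_(j <- [seq j <- UT | (dm [set j] < dd)%N]) (surv [set j] n y)%:E)%E.
Proof.
move=> y0; have t0 := scaled_time_gt0 m dd n y y0.
have ma j := measurable_avoid q rho P X Xiid n.+1 [set j] (time n y).
have mc : measurable (cover_ge n y) by exact: (measurable_cover_time_ge q rho P X Xiid).
have mf : measurable (far_union n y).
  by apply: fin_bigcup_measurable => // ; exact: finite_finset.
split.
  apply: le_measure; rewrite ?inE// => w [j _ aj] /=; apply/cover_time_geP => //.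
  by exists (val j) => //; case: (farP _ (valP j)).
set s := [seq _ <- _ | _].
have mn : measurable (\big[setU/classical_sets.set0]_(j <- s) avoid X n.+1 [set j] (time n y)).
  by apply: bigsetU_measurable.
apply: (@le_trans _ _ (P (far_union n y `|` \big[setU/classical_sets.set0]_(j <- s) avoid X n.+1 [set j] (time n y)))).
  apply: le_measure; rewrite ?inE//; first exact: measurableU.
  move=> w /= /cover_time_geP => /(_ t0)[j jU aj].
  have [jd|jd] := eqVneq (dm [set j]) dd.
    have jF : j \in F by rewrite !inE jU jd /=.
    by left; exists [` jF]%fset.
  right; rewrite -bigcup_seq; exists j => //=.
  by rewrite mem_filter jU andbT ltn_neqAle jd (dmin_le_dfar q rho UT).
apply: le_trans (measureU2 _ _ _) _ => //; apply: leeD2l.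
elim: s mn => [|j s IH] mn; first by rewrite !big_nil measure0.
rewrite !big_cons; apply: le_trans (measureU2 _ _ _) _ => //.
  by apply: bigsetU_measurable.
apply: leeD; last by apply: IH; apply: bigsetU_measurable.
by rewrite /scaled_survival -(avoid_indep q rho P X Xiid _ _ _ (ltW t0)).
Qed.

Let measurable_cover_prob n : measurable_fun D0 (fun y => P (cover_ge n y)).
Proof.
have mc y : 0 < y -> measurable (cover_ge n y).
  by move=> y0; apply: (measurable_cover_time_ge q rho P X Xiid); exact: scaled_time_gt0.
have h : measurable_fun D0 (fun y => (fine (P (cover_ge n y)))%:E).
  apply/measurable_EFinP; apply: antitone_measurable; first exact: interval_is_interval.
  move=> x y /D0P x0 /D0P y0 xy; apply: fine_le.
  - by apply: fin_num_measure; exact: mc.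
  - by apply: fin_num_measure; exact: mc.
  apply: le_measure; rewrite ?inE; [exact: mc|exact: mc|move=> w /=].
  apply: le_trans; rewrite lee_fin.
  apply: ler_wpM2r; first exact: powR_ge0.
  by apply: ge0_ler_powR; rewrite ?nnegrE ?invr_ge0 ?(ltW m_gt0) ?(ltW x0) ?(ltW y0).
apply: eq_measurable_fun h => y; rewrite inE => /D0P y0.
by rewrite fineK// fin_num_measure//; exact: mc.
Qed.

Lemma cvg_cover_time_moment :
  ((n.+1%:R `^ (m / dd%:R))%:E * \int[P]_w (cover_time X UT n.+1 w `^ m))%E
    @[n --> \oo] --> (Kconst q rho UT m)%:E.
Proof.
have [C [n0 [C0 dom]]] := scaled_survival_bounded q rho P X UT m qgen qbnd rhoP Xiid UT_out UT_hit m_gt0.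
have sJ (J : {set F}) : (0 < #|J|)%N -> exists j, jset J j /\ j \in UT.
  move=> /card_gt0P[x xJ]; exists (val x); split; first by exists x.
  by have [] := farP _ (valP x).
have far_hyp (J : {set F}) : forall j, jset J j -> j \in UT /\ dm [set j] = dd.
  by move=> _ [x _ <-]; exact: farP (valP x).
have intJ (J : {set F}) n : (0 < #|J|)%N -> (n0 <= n)%N ->
    leb.-integrable D0 (EFin \o scaled_survival q rho P X UT m (jset J) n).
  move=> /sJ[j [Jj jU]] n0n.
  exact: (integrable_scaled_survival q rho P X UT m Xiid m_gt0 C n0 C0 dom (jset J) j n Jj jU n0n).
(* The signs alternate, so linearity of the integral needs each term integrable; hence the shift of
   the index beyond [n0]. *)
have farI k : (\int[leb]_(y in D0) (far_prob (k + n0) y)%:E =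
    (\sum_(J : {set F} | (0 < #|J|)%N) (-1) ^+ #|J|.-1 * fine (mom (jset J) (k + n0)))%:E)%E.
  pose h (J : {set F}) y : \bar R := if (0 < #|J|)%N then
     (((-1) ^+ #|J|.-1)%:E * (surv (jset J) (k + n0) y)%:E)%E else 0%E.
  transitivity (\int[leb]_(y in D0) \sum_(J : {set F}) h J y)%E.
    apply: eq_integral => y _; rewrite /far_prob -sumEFin big_mkcond/=; apply: eq_bigr => J _.
    by rewrite /h; case: ifP.
  rewrite integral_sum//; last first.
    move=> J; rewrite /h; case: (boolP (0 < #|J|)%N) => J0; last exact: integrable0.
    by apply: integrableZl => //; apply: intJ => //; exact: leq_addl.
  rewrite -sumEFin [RHS]big_mkcond/=; apply: eq_bigr => J _; rewrite /h.
  case: ifP => J0; last by rewrite integral0.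
  have iJ := intJ J (k + n0)%N J0 (leq_addl _ _).
  by rewrite integralZl// EFinM fineK//; exact: integrable_fin_num iJ.
have farC : (\int[leb]_(y in D0) (far_prob (k + n0) y)%:E)%E @[k --> \oo] --> (Kconst q rho UT m)%:E.
  rewrite (_ : (fun k => _) = EFin \o (fun k =>
    \sum_(J : {set F} | (0 < #|J|)%N) (-1) ^+ #|J|.-1 * fine (mom (jset J) (k + n0)))); last first.
    by apply/funext => k; rewrite farI.
  apply: cvg_EFin; first exact: nearW.
  rewrite /Kconst sum_by_card mulr_sumr.
  apply: cvg_big; first exact: add_continuous.
  move=> J J0; rewrite mulrCA; apply: cvgM; first exact: cvg_cst.
  apply: fine_cvg; rewrite mulrC.
  have := cvg_moment_far q rho P X UT m qgen qbnd rhoP Xiid UT_out UT_hit m_gt0 C n0 dom (jset J) _ (far_hyp J).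
  by apply; have [j [Jj _]] := sJ J J0; exists j.
pose s := [seq j <- UT | (dm [set j] < dd)%N].
have nearC : (\sum_(j <- s) mom [set j] (k + n0))%E @[k --> \oo] --> 0%E.
  rewrite -[X in _ --> X](_ : (\sum_(j <- s) 0)%E = 0%E); last by rewrite big1.
  rewrite big_seq; under eq_fun do rewrite big_seq.
  apply: cvg_nnesum => j.
    by move=> _; apply: nearW => k; apply: integral_ge0 => y _; rewrite lee_fin; exact: scaled_survival_ge0.
  rewrite mem_filter => /andP[jd jU].
  exact: (cvg_moment_near q rho P X UT m qgen qbnd rhoP Xiid UT_hit m_gt0 C n0 dom j jU jd).
rewrite -(cvg_shiftn n0) /=.
have upperC : ((\int[leb]_(y in D0) (far_prob (k + n0) y)%:E +
    \sum_(j <- s) mom [set j] (k + n0)))%E @[k --> \oo] --> (Kconst q rho UT m)%:E.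
  by rewrite -[X in _ --> X]adde0; apply: cvgeD => //; rewrite fin_num_adde_defl.
apply: squeeze_cvge farC upperC.
apply: nearW => k; rewrite moment_cover_time.
(* It remains to integrate the two bounds of [cover_ge_bounds]; the squeeze then applies because the
   near moments tend to 0. *)
have mfar : measurable_fun D0 (fun y => (far_prob (k + n0) y)%:E).
  apply/measurable_EFinP.
  rewrite (_ : far_prob (k + n0) = fun y => \sum_(J : {set F})
    if (0 < #|J|)%N then (-1) ^+ #|J|.-1 * surv (jset J) (k + n0) y else 0); last first.
    by apply/funext => y; rewrite /far_prob big_mkcond.
  apply: measurable_sum => J; case: (boolP (0 < #|J|)%N) => // _; apply: measurable_funM => //.
  exact: (measurable_scaled_survival q rho P X UT m Xiid m_gt0).
have far0 y : D0 y -> (0 <= (far_prob (k + n0) y)%:E)%E by move=> /D0P y0; rewrite -far_unionE.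
have ms j : measurable_fun D0 (fun y => (surv [set j] (k + n0) y)%:E).
  by apply/measurable_EFinP; exact: (measurable_scaled_survival q rho P X UT m Xiid m_gt0).
have s0 j y : (0 <= (surv [set j] (k + n0) y)%:E)%E by rewrite lee_fin; exact: scaled_survival_ge0.
apply/andP; split.
  apply: ge0_le_integral => //; first exact: measurable_cover_prob.
  by move=> y /D0P y0; rewrite -far_unionE//; have [] := cover_ge_bounds (k + n0) y y0.
rewrite /moment -ge0_integral_sum// -ge0_integralD//; last 2 first.
- by move=> y _; apply: sume_ge0.
- exact: emeasurable_sum.
apply: ge0_le_integral => //.
- exact: measurable_cover_prob.
- by apply: emeasurable_funD => //; exact: emeasurable_sum.
by move=> y /D0P y0; rewrite -far_unionE//; have [] := cover_ge_bounds (k + n0) y y0.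
Qed.

End assembly.

Theorem theorem1 (R : realType) (I : countType) (q : I -> I -> R) (rho : I -> R)
  (d : measure_display) (Omega : measurableType d) (P : probability Omega R)
  (X : nat -> Omega -> R -> I) (UT : {fset I}) :
  is_generator q ->
  bounded_rates q ->
  is_distribution rho ->
  iid_CTMC q rho P X ->
  (* (i) *)
  ~ ([set j | j \in UT] `<=` supp rho) ->
  (* (ii) *)
  (forall j, j \in UT ->
     exists N : nat, (1 <= N)%N /\
       (\int[P]_w first_hit X N j w < +oo)%E) ->
  forall m : R, 0 < m ->
    (fun N : nat =>
       ((N%:R `^ (m / (dfar q rho UT)%:R))%:E
        * \int[P]_w (cover_time X UT N w `^ m))%E)
    @ \oo --> (Kconst q rho UT m)%:E.
Proof.
move=> qgen qbnd rhoP Xiid UT_out UT_hit m m0.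
(* The estimates concern [n.+1] searchers; the limit ignores the term [N = 0]. *)
rewrite -cvg_shiftS; exact: (cvg_cover_time_moment q rho P X UT m qgen qbnd rhoP Xiid UT_out UT_hit m0).
Qed.
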